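(* Let $(H,\boldsymbol g)$ be a finite-dimensional pivotal Hopf algebra over a field $\Bbbk$ with modulus $\boldsymbol\alpha\in H^*$, and let $\nu\in H^*$ be a group-like functional. The space of right module traces on $(H\text{-pmod},R(\nu)_* )$ is $1$-dimensional for $\nu=\boldsymbol\alpha$ and trivial otherwise. In the first case, the (non-zero) traces are non-degenerate, and the traces are determined by $$\mathsf t_H(f)=\boldsymbol\mu\bigl(\boldsymbol g f(1)\bigr)$$ for all $f\colon H\to R(\boldsymbol\alpha)_*(H)$, where $\boldsymbol\mu$ is a right integral. Similarly, the space of left module traces on $(H\text{-pmod},L(\nu)_* )$ is $1$-dimensional for $\nu=\boldsymbol\alpha$ and trivial otherwise, and in the first case $$\mathsf t_H(f)=\boldsymbol\mu^l\bigl(\boldsymbol g^{-1} f(1)\bigr)$$ for all $f\colon H\to L(\boldsymbol\alpha)_*(H)$, where $\boldsymbol\mu^l$ is a left integral. In particular, $H$-pmod has a non-zero right or left modified trace if and only if $H$ is unimodular.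
   Context: $H$-mod is the category of finite-dimensional left $H$-modules, $H$-pmod its full subcategory of projective modules. A pivotal Hopf algebra $(H,\boldsymbol g)$ is a Hopf algebra with a group-like element $\boldsymbol g$ such that $S^2(a)=\boldsymbol g a\boldsymbol g^{-1}$ for all $a$. For $V\in H$-mod with basis $\{v_i\}$: $\mathrm{ev}_V(\xi\otimes v)=\xi(v)$, $\mathrm{coev}_V(1)=\sum v_i\otimes v_i^*$, $\widetilde{\mathrm{ev}}_V(v\otimes\xi)=\xi(\boldsymbol g v)$, $\widetilde{\mathrm{coev}}_V(1)=\sum v_i^*\otimes\boldsymbol g^{-1}v_i$. If $\boldsymbol c$ is a nonzero left cointegral ($a\boldsymbol c=\varepsilon(a)\boldsymbol c$ for all $a$), the modulus is the group-like functional (algebra map) $\boldsymbol\alpha\colon H\to\Bbbk$ with $\boldsymbol c a=\boldsymbol\alpha(a)\boldsymbol c$. $H$ is unimodular if $\boldsymbol\alpha=\varepsilon$. A right integral $\boldsymbol\mu\in H^*$ satisfies $(\boldsymbol\mu\otimes\mathrm{id})\Delta(a)=\boldsymbol\mu(a)1$; a left integral satisfies $(\mathrm{id}\otimes\boldsymbol\mu^l)\Delta(a)=\boldsymbol\mu^l(a)1$. For group-like $\nu\in H^*$ (an algebra map $H\to\Bbbk$), $R(\nu)=(\nu\otimes\mathrm{id})\Delta$ and $L(\nu)=(\mathrm{id}\otimes\nu)\Delta$ are algebra automorphisms of $H$. For an algebra automorphism $\varphi$, the twist functor $\varphi_*$ sends a module $V$ to the same vector space with action $a\cdot_\varphi v=\varphi(a)v$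 and is the identity on morphisms. One has $R(\nu)_*(P\otimes V)=R(\nu)_*(P)\otimes V$ and $L(\nu)_*(V\otimes P)=V\otimes L(\nu)_*(P)$. A right module trace on $(H\text{-pmod},\Sigma)$ with $\Sigma=R(\nu)_*$ is a family of linear maps $\{\mathsf t_P\colon\mathrm{Hom}_H(P,\Sigma P)\to\Bbbk\}_{P\in H\text{-pmod}}$ with (1) $\mathsf t_P(f\circ g)=\mathsf t_{P'}(\Sigma(g)\circ f)$ for all $g\colon P\to P'$, $f\colon P'\to\Sigma P$; (2) $\mathsf t_{P\otimes V}(f)=\mathsf t_P\bigl((\mathrm{id}\otimes\widetilde{\mathrm{ev}}_V)(f\otimes\mathrm{id}_{V^*})(\mathrm{id}_P\otimes\mathrm{coev}_V)\bigr)$ for all $P\in H$-pmod, $V\in H$-mod, $f\colon P\otimes V\to\Sigma(P\otimes V)=\Sigma(P)\otimes V$. A left module trace (with $\Sigma=L(\nu)_*$) satisfies (1) and instead $\mathsf t_{V\otimes P}(f)=\mathsf t_P\bigl((\mathrm{ev}_V\otimes\mathrm{id})(\mathrm{id}_{V^*}\otimes f)(\widetilde{\mathrm{coev}}_V\otimes\mathrm{id}_P)\bigr)$ for all $f\colon V\otimes P\to\Sigma(V\otimes P)=V\otimes\Sigma(P)$. A right (left) modified trace on $H$-pmod is a right (left) module trace for $\Sigma=\mathrm{Id}$. A trace is non-degenerate if all pairings $\mathrm{Hom}_H(P',\Sigma P)\times\mathrm{Hom}_H(P,P')\to\Bbbk$, $(f,g)\mapsto\mathsf t_P(f\circ g)$,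 are non-degenerate. *)

(* Defs.v *)
From HB Require Import structures.
From mathcomp Require Import all_boot all_order all_algebra all_field.
Set Implicit Arguments.
Unset Strict Implicit.
Unset Printing Implicit Defensive.
Import GRing.Theory.
Local Open Scope ring_scope.

(* V (x) W is encoded by the coordinates of a tensor in the bases vbasis {:V} *)
(* and vbasis {:W}; tliftE and tens_eq below are its universal property.      *)
Section Tensor.
Variable K : fieldType.
Implicit Types U V W : vectType K.

Definition tens V W : vectType K := 'M[K]_(\dim {:V}, \dim {:W}).

Definition tcoord V W (T : tens V W) i j : K :=
  (T : 'M[K]_(\dim {:V}, \dim {:W})) i j.

Definition triv : vectType K := K^o.
Definition dual V : vectType K := 'Hom(V, triv).

Definition bvec V (i : 'I_(\dim {:V})) : V := (vbasis {:V})`_i.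

Definition bcovec V (i : 'I_(\dim {:V})) : dual V :=
  linfun (coord (vbasis {:V}) i : V -> K^o).

Definition pure V W (v : V) (w : W) : tens V W :=
  (\matrix_(i, j) (coord (vbasis {:V}) i v * coord (vbasis {:W}) j w))%R.

Lemma tcoord_lin V W i j : scalar (fun T : tens V W => tcoord T i j).
Proof. by move=> k S T; rewrite /tcoord !mxE. Qed.

Lemma tcoord_eq V W (S T : tens V W) : (forall i j, tcoord S i j = tcoord T i j) -> S = T.
Proof. by move=> ST; apply/matrixP. Qed.

Lemma tcoord_pure V W (v : V) (w : W) i j :
  tcoord (pure v w) i j = coord (vbasis {:V}) i v * coord (vbasis {:W}) j w.
Proof. by rewrite /tcoord mxE. Qed.

Definition tlift_def V W U (b : V -> W -> U) (T : tens V W) : U :=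
  \sum_i \sum_j tcoord T i j *: b (bvec i) (bvec j).

(* The linear map on V (x) W induced by b, when b is bilinear. *)
Definition tlift V W U (b : V -> W -> U) : 'Hom(tens V W, U) :=
  linfun (tlift_def b).

Lemma tlift_is_linear V W U (b : V -> W -> U) : linear (tlift_def b).
Proof.
move=> k S T; rewrite /tlift_def scaler_sumr -big_split; apply: eq_bigr => i _ /=.
rewrite scaler_sumr -big_split; apply: eq_bigr => j _ /=.
by rewrite tcoord_lin scalerDl scalerA.
Qed.
HB.instance Definition _ V W U (b : V -> W -> U) :=
  GRing.isLinear.Build K (tens V W) U _ (tlift_def b) (tlift_is_linear b).

Lemma tliftT V W U (b : V -> W -> U) T :
  tlift b T = \sum_i \sum_j tcoord T i j *: b (bvec i) (bvec j).
Proof. by rewrite lfunE. Qed.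

Lemma bvecE V (v : V) : v = \sum_i coord (vbasis {:V}) i v *: bvec i.
Proof. by rewrite {1}(coord_vbasis (memvf v)). Qed.

Lemma linD (V W : lmodType K) (f : V -> W) : linear f ->
  (forall u v, f (u + v) = f u + f v) * (f 0 = 0) * (forall k v, f (k *: v) = k *: f v).
Proof.
move=> lf; have fD u v: f (u + v) = f u + f v by rewrite -{1}[u]scale1r lf scale1r.
have f0 : f 0 = 0 by apply: (addIr (f 0)); rewrite -fD !add0r.
split; first by split.
by move=> k v; rewrite -{1}[k *: v]addr0 lf f0 addr0.
Qed.

Lemma linS (V W : lmodType K) (f : V -> W) : linear f ->
  forall n (F : 'I_n -> V), f (\sum_i F i) = \sum_i f (F i).
Proof.
move=> lf n F; elim: n F => [|n IH] F; first by rewrite !big_ord0 (linD lf).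
by rewrite !big_ord_recl (linD lf) IH.
Qed.

Lemma tliftE V W U (b : V -> W -> U) v w :
    (forall w, linear (b^~ w)) -> (forall v, linear (b v)) ->
  tlift b (pure v w) = b v w.
Proof.
move=> bl br; rewrite tliftT {2}[v]bvecE (linS (bl w)); apply: eq_bigr => i _.
rewrite (linD (bl w)) {2}[w]bvecE (linS (br _)) scaler_sumr; apply: eq_bigr => j _.
by rewrite (linD (br _)) scalerA tcoord_pure.
Qed.

Lemma pure_linl V W (w : W) : linear (fun v : V => pure v w).
Proof. by move=> k u v; apply/tcoord_eq=> i j; rewrite tcoord_lin !tcoord_pure linearP mulrDl mulrA. Qed.

Lemma pure_linr V W (v : V) : linear (fun w : W => pure v w).
Proof.
by move=> k u w; apply/tcoord_eq=> i j; rewrite tcoord_lin !tcoord_pure linearP mulrDr mulrCA.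
Qed.

Lemma tensE V W (T : tens V W) :
  T = \sum_i \sum_j tcoord T i j *: pure (bvec i) (bvec j).
Proof.
rewrite [LHS]matrix_sum_delta; apply: eq_bigr => i _; apply: eq_bigr => j _.
congr (_ *: _); apply/tcoord_eq=> k l; rewrite tcoord_pure /tcoord mxE /bvec.
rewrite !coord_free ?(basis_free (vbasisP _)) //.
by rewrite -natrM mulnb [k == i]eq_sym [l == j]eq_sym.
Qed.

Lemma tens_eq V W U (f g : 'Hom(tens V W, U)) :
  (forall v w, f (pure v w) = g (pure v w)) -> f = g.
Proof.
move=> fg; apply/lfunP=> T; rewrite [T]tensE !linear_sum; apply: eq_bigr => i _.
by rewrite !linear_sum; apply: eq_bigr => j _; rewrite !linearZ /= fg.
Qed.

Lemma eq_tlift V W U (b c : V -> W -> U) T :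
  (forall v w, b v w = c v w) -> tlift b T = tlift c T.
Proof.
by move=> bc; rewrite !tliftT; apply: eq_bigr => i _; apply: eq_bigr => j _; rewrite bc.
Qed.

Lemma tlift_push V W U U' (f : U -> U') (b : V -> W -> U) T : linear f ->
  f (tlift b T) = tlift (fun v w => f (b v w)) T.
Proof.
move=> lf; rewrite !tliftT (linS lf); apply: eq_bigr => i _.
by rewrite (linS lf); apply: eq_bigr => j _; rewrite (linD lf).
Qed.

Lemma lin_id V : linear (fun v : V => v). Proof. by []. Qed.

Lemma lin_tlift V W U U' (b : U' -> V -> W -> U) T :
  (forall v w, linear (fun x => b x v w)) -> linear (fun x => tlift (b x) T).
Proof.
move=> lb k x y /=; rewrite !tliftT scaler_sumr -big_split; apply: eq_bigr => i _ /=.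
rewrite scaler_sumr -big_split; apply: eq_bigr => j _ /=.
by rewrite (lb _ _ k) scalerDr !scalerA mulrC.
Qed.

Lemma lin_comp (U V W : lmodType K) (f : V -> W) (g : U -> V) :
  linear f -> linear g -> linear (fun x => f (g x)).
Proof. by move=> lf lg k u v /=; rewrite lg lf. Qed.

Lemma lin_purel U V W (f : U -> V) (w : W) : linear f -> linear (fun x => pure (f x) w).
Proof. exact: lin_comp (pure_linl w). Qed.
Lemma lin_purer U V W (f : U -> W) (v : V) : linear f -> linear (fun x => pure v (f x)).
Proof. exact: lin_comp (pure_linr v). Qed.
Lemma lin_hom U V W (h : 'Hom(V, W)) (f : U -> V) : linear f -> linear (fun x => h (f x)).
Proof. by apply: lin_comp; exact: linearP. Qed.
Lemma lin_hom_app U V W (h : U -> 'Hom(V, W)) v : linear h -> linear (fun x => h x v).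
Proof. by move=> lh k x y; rewrite lh add_lfunE scale_lfunE. Qed.
Lemma lin_lin (U V W : lmodType K) (h : {linear V -> W}) (f : U -> V) :
  linear f -> linear (fun x => h (f x)).
Proof. by apply: lin_comp; exact: linearP. Qed.
Lemma lin_scalel U V (f : U -> K) (v : V) : scalar f -> linear (fun x => f x *: v).
Proof. by move=> lf k x y /=; rewrite lf scalerDl scalerA. Qed.
Lemma lin_scalar U V (f : {scalar V}) (g : U -> V) :
  linear g -> scalar (fun x => f (g x)).
Proof. by move=> lg k x y /=; rewrite lg linearP. Qed.

Lemma lin_scaler U V (c : K) (f : U -> V) : linear f -> linear (fun x => c *: f x).
Proof. by move=> lf k x y /=; rewrite lf scalerDr !scalerA mulrC. Qed.
Lemma lin_mull U (A : falgType K) (f : U -> A) a : linear f -> linear (fun x => f x * a).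
Proof. by move=> lf k x y /=; rewrite lf mulrDl scalerAl. Qed.
Lemma lin_mulr U (A : falgType K) (f : U -> A) a : linear f -> linear (fun x => a * f x).
Proof. by move=> lf k x y /=; rewrite lf mulrDr scalerAr. Qed.
Lemma lin_compl U V W X (f : U -> 'Hom(V, W)) (g : 'Hom(X, V)) :
  linear f -> linear (fun x => (f x \o g)%VF).
Proof. by move=> lf k x y /=; rewrite lf comp_lfunDl comp_lfunZl. Qed.
Lemma lin_compr U V W X (f : U -> 'Hom(V, W)) (g : 'Hom(W, X)) :
  linear f -> linear (fun x => (g \o f x)%VF).
Proof. by move=> lf k x y /=; rewrite lf comp_lfunDr comp_lfunZr. Qed.
Lemma lin_sum U V n (f : 'I_n -> U -> V) :
  (forall i, linear (f i)) -> linear (fun x => \sum_i f i x).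
Proof.
move=> lf k x y /=; rewrite scaler_sumr -big_split; apply: eq_bigr => i _ /=.
exact: lf.
Qed.

Lemma tlift_sum V W U n (F : 'I_n -> V -> W -> U) T :
  tlift (fun v w => \sum_i F i v w) T = \sum_i tlift (F i) T.
Proof.
rewrite tliftT.
under eq_bigr do under eq_bigr do rewrite scaler_sumr.
under eq_bigr do rewrite exchange_big /=.
by rewrite exchange_big; apply: eq_bigr => i _; rewrite tliftT.
Qed.

Lemma tlift_scale V W U c (b : V -> W -> U) T :
  tlift (fun v w => c *: b v w) T = c *: tlift b T.
Proof. by rewrite -(tlift_push (f := fun x => c *: x)) //; apply: lin_scaler. Qed.

Lemma tlift_exchange V W V' W' U (b : V -> W -> V' -> W' -> U) S T :
  tlift (fun v w => tlift (b v w) T) S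
    = tlift (fun v' w' => tlift (fun v w => b v w v' w') S) T.
Proof.
rewrite [LHS]tliftT (eq_tlift (c := fun v' w' => \sum_i \sum_j tcoord S i j *:
  b (bvec i) (bvec j) v' w')); last by move=> v w; rewrite tliftT.
rewrite tlift_sum; apply: eq_bigr => i _; rewrite tlift_sum; apply: eq_bigr => j _.
by rewrite tlift_scale.
Qed.


Definition tmap V V' W W' (f : 'Hom(V, V')) (g : 'Hom(W, W')) :
    'Hom(tens V W, tens V' W') := tlift (fun v w => pure (f v) (g w)).

Definition tassoc U V W : 'Hom(tens (tens U V) W, tens U (tens V W)) :=
  tlift (fun T w => tlift (fun u v => pure u (pure v w)) T).

Definition tassocV U V W : 'Hom(tens U (tens V W), tens (tens U V) W) :=
  tlift (fun u T => tlift (fun v w => pure (pure u v) w) T).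

(* Product of the tensor product algebra. *)
Definition tmul (A B : falgType K) (S T : tens A B) : tens A B :=
  tlift (fun a b => tlift (fun c d => pure (a * c) (b * d)) T) S.

End Tensor.

HB.mixin Record Falgebra_isHopf (K : fieldType) H of Falgebra K H := {
  comult : 'Hom(H, tens H H);
  counit : {lrmorphism H -> K | *%R};
  antipode : 'End(H);
  comult1 : comult 1 = pure 1 1;
  comultM : forall a b, comult (a * b) = tmul (comult a) (comult b);
  comultA : (tassoc H H H \o tmap comult \1 \o comult
              = tmap \1 comult \o comult)%VF;
  counitl : forall a, tlift (fun x y : H => counit x *: y) (comult a) = a;
  counitr : forall a, tlift (fun x y : H => counit y *: x) (comult a) = a;
  antipodel : forall a,
    tlift (fun x y : H => antipode x * y) (comult a) = counit a *: 1;
  antipoder : forall a,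
    tlift (fun x y : H => x * antipode y) (comult a) = counit a *: 1 }.

#[short(type="hopfAlgType")]
HB.structure Definition Hopf (K : fieldType) :=
  { H of Falgebra_isHopf K H & Falgebra K H }.

(* Sweedler notation: \sw_(x, y <- a) E is the sum of E over a_(1) = x and   *)
(* a_(2) = y, for an expression E bilinear in x and y.                        *)
Definition sw (K : fieldType) (H : hopfAlgType K) (U : vectType K) (a : H)
  (E : H -> H -> U) : U := tlift E (comult a).
Notation "\sw_ ( x , y <- a ) E" := (sw a (fun x y => E))
  (at level 41, E at level 41, x name, y name,
   format "\sw_ ( x ,  y  <-  a )  E") : ring_scope.

Lemma eq_sw (K : fieldType) (H : hopfAlgType K) (U : vectType K) (a : H)
    (E F : H -> H -> U) : (forall x y, E x y = F x y) -> sw a E = sw a F.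
Proof. exact: eq_tlift. Qed.

Lemma lin_sw (K : fieldType) (H : hopfAlgType K) (U V : vectType K) (a : H)
    (E : V -> H -> H -> U) :
  (forall x y, linear (fun v => E v x y)) -> linear (fun v => sw a (E v)).
Proof. exact: lin_tlift. Qed.

Lemma lin_swa (K : fieldType) (H : hopfAlgType K) (U V : vectType K) (f : V -> H)
    (E : H -> H -> U) : linear f -> linear (fun v => sw (f v) E).
Proof. by move=> lf; apply: lin_hom; apply: lin_hom. Qed.

Lemma sw_push (K : fieldType) (H : hopfAlgType K) (U V : vectType K) (a : H)
  (f : U -> V) (E : H -> H -> U) : linear f -> f (sw a E) = \sw_(x, y <- a) f (E x y).
Proof. exact: tlift_push. Qed.

Lemma sw_hom (K : fieldType) (H : hopfAlgType K) (U V : vectType K) (a : H)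
  (f : 'Hom(U, V)) (E : H -> H -> U) : f (sw a E) = \sw_(x, y <- a) f (E x y).
Proof. exact: tlift_push (linearP f). Qed.

Lemma sw_scale (K : fieldType) (H : hopfAlgType K) (U : vectType K) (a : H)
  (c : K) (E : H -> H -> U) : \sw_(x, y <- a) (c *: E x y) = c *: sw a E.
Proof. exact: tlift_scale. Qed.

Lemma sw_exchange (K : fieldType) (H : hopfAlgType K) (U : vectType K) (a b : H)
    (E : H -> H -> H -> H -> U) :
  \sw_(x, y <- a) \sw_(x', y' <- b) E x y x' y'
    = \sw_(x', y' <- b) \sw_(x, y <- a) E x y x' y'.
Proof. exact: tlift_exchange. Qed.

Ltac lin1 := first
  [ eassumption | apply lin_id | apply lin_purel | apply lin_purer
  | apply lin_mull | apply lin_mulr | apply lin_scalel | apply lin_scaler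
  | apply lin_sw | apply lin_swa | apply lin_hom | apply lin_tlift | apply lin_sum | apply lin_hom_app
  | apply lin_compl | apply lin_compr
  | apply lin_lin | apply lin_scalar ].
Ltac lin := simpl; intros; repeat (lin1; simpl; intros).

Section HopfTheory.
Variables (K : fieldType) (H : hopfAlgType K).
Implicit Types (a b c x y : H) (U V W : vectType K).
Notation S := (antipode : 'End(H)).

Lemma tmapE V V' W W' (f : 'Hom(V, V')) (g : 'Hom(W, W')) v w :
  tmap f g (pure v w) = pure (f v) (g w).
Proof. by rewrite /tmap tliftE //; lin. Qed.

Lemma tassocE U V W (u : U) (v : V) (w : W) :
  tassoc U V W (pure (pure u v) w) = pure u (pure v w).
Proof. by rewrite /tassoc tliftE; [rewrite tliftE // | | ]; lin. Qed.

Lemma tassocVE U V W (u : U) (v : V) (w : W) :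
  tassocV U V W (pure u (pure v w)) = pure (pure u v) w.
Proof. by rewrite /tassocV tliftE; [rewrite tliftE // | | ]; lin. Qed.

Lemma tpureE V W (T : tens V W) : T = tlift (@pure K V W) T.
Proof. by rewrite tliftT -tensE. Qed.

Lemma tlift_hom V W U U' (h : 'Hom(U, U')) (b : V -> W -> U) T :
  h (tlift b T) = tlift (fun v w => h (b v w)) T.
Proof. by apply: tlift_push; lin. Qed.

Lemma tlift_sw V W U a (E : H -> H -> tens V W) (b : V -> W -> U) :
  tlift b (sw a E) = \sw_(x, y <- a) tlift b (E x y).
Proof. exact: sw_hom. Qed.

Lemma swA U (t : H -> H -> H -> U) a :
    (forall y z, linear (fun x => t x y z)) ->
    (forall x z, linear (fun y => t x y z)) -> (forall x y, linear (t x y)) ->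
  \sw_(x, z <- a) \sw_(x', y <- x) t x' y z
    = \sw_(x, y <- a) \sw_(y', z <- y) t x y' z.
Proof.
move=> l1 l2 l3.
have := congr1 (fun f : 'Hom(_, _) => tlift (fun x T => tlift (t x) T) (f a)) comultA.
rewrite !comp_lfunE => E; transitivity (tlift (fun x T => tlift (t x) T)
    (tassoc H H H (tmap comult \1%VF (comult a)))).
  rewrite /tmap 2!tlift_hom; apply: eq_sw => x z.
  rewrite id_lfunE /tassoc tliftE; [|by lin..].
  by rewrite tlift_hom; apply: eq_sw => x' y; rewrite !tliftE //; lin.
rewrite E /tmap tlift_hom; apply: eq_sw => x y.
by rewrite id_lfunE tliftE //; lin.
Qed.

Lemma swM U (t : H -> H -> U) a b :
    (forall y, linear (fun x => t x y)) -> (forall x, linear (t x)) ->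
  \sw_(x, y <- a * b) t x y
    = \sw_(x, y <- a) \sw_(x', y' <- b) t (x * x') (y * y').
Proof.
move=> l1 l2; rewrite /sw comultM /tmul tlift_hom; apply: eq_sw => x y.
by rewrite tlift_hom; apply: eq_sw => x' y'; rewrite tliftE //; lin.
Qed.

Lemma sw1 U (t : H -> H -> U) :
  (forall y, linear (fun x => t x y)) -> (forall x, linear (t x)) ->
  \sw_(x, y <- 1) t x y = t 1 1.
Proof. by move=> l1 l2; rewrite /sw comult1 tliftE. Qed.

Lemma sw_counitl U (f : H -> U) a : linear f -> \sw_(x, y <- a) (counit x *: f y) = f a.
Proof.
move=> lf; rewrite -{2}[a]counitl -/(sw _ _) (sw_push _ _ lf).
by apply: eq_sw => x y; rewrite (linD lf).
Qed.

Lemma sw_counitr U (f : H -> U) a : linear f -> \sw_(x, y <- a) (counit y *: f x) = f a.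
Proof.
move=> lf; rewrite -{2}[a]counitr -/(sw _ _) (sw_push _ _ lf).
by apply: eq_sw => x y; rewrite (linD lf).
Qed.

Lemma sw_antipodel U (f : H -> U) a : linear f ->
  \sw_(x, y <- a) f (S x * y) = counit a *: f 1.
Proof. by move=> lf; rewrite -(sw_push _ _ lf) [sw _ _]antipodel (linD lf). Qed.

Lemma sw_antipoder U (f : H -> U) a : linear f ->
  \sw_(x, y <- a) f (x * S y) = counit a *: f 1.
Proof. by move=> lf; rewrite -(sw_push _ _ lf) [sw _ _]antipoder (linD lf). Qed.

Lemma antipode1 : S 1 = 1.
Proof.
have := antipodel (1 : H); rewrite comult1 tliftE; [|by lin..].
by rewrite rmorph1 scale1r mulr1.
Qed.

Lemma antipodeM a b : S (a * b) = S b * S a.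
Proof.
symmetry; rewrite -(sw_counitr (f := fun x => S b * S x) a); last by lin.
transitivity (\sw_(x, y <- a) \sw_(x', y' <- b) (counit (y * y') *: (S x' * S x))).
  apply: eq_sw => x y; symmetry.
  rewrite -(sw_counitr (f := fun x' => S x' * S x) b); last by lin.
  by rewrite -sw_scale; apply: eq_sw => x' y'; rewrite rmorphM scalerA.
transitivity (\sw_(x, y <- a) \sw_(x', y' <- b) \sw_(p, q <- y) \sw_(p', q' <- y')
  (S x' * (S x * p) * p' * S (q * q'))).
  apply: eq_sw => x y; apply: eq_sw => x' y'.
  rewrite -[S x' * S x]mulr1.
  rewrite -(sw_antipoder (f := fun z => S x' * S x * z) (y * y')); last by lin.
  rewrite swM; [|by lin..]; apply: eq_sw => p q; apply: eq_sw => p' q'.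
  by rewrite !mulrA.
transitivity (\sw_(x, y <- a) \sw_(p, q <- y) \sw_(x', y' <- b) \sw_(p', q' <- y')
  (S x' * (S x * p) * p' * S (q * q'))).
  by apply: eq_sw => x y; rewrite sw_exchange.
rewrite -(swA (t := fun x p q => \sw_(x', y' <- b) \sw_(p', q' <- y')
  (S x' * (S x * p) * p' * S (q * q')))); [|by lin..].
transitivity (\sw_(x, q <- a) (counit x *: \sw_(x', y' <- b) \sw_(p', q' <- y')
  (S x' * p' * S (q * q')))).
  apply: eq_sw => x q.
  rewrite (sw_antipodel (f := fun z => \sw_(x', y' <- b) \sw_(p', q' <- y')
    (S x' * z * p' * S (q * q')))); last by lin.
  congr (_ *: _); apply: eq_sw => x' y'; apply: eq_sw => p' q'.
  by rewrite mulr1.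
rewrite (sw_counitl (f := fun q => \sw_(x', y' <- b) \sw_(p', q' <- y')
  (S x' * p' * S (q * q')))); last by lin.
rewrite -(swA (t := fun x p q => S x * p * S (a * q))); [|by lin..].
transitivity (\sw_(y, z <- b) (counit y *: S (a * z))).
  apply: eq_sw => y z.
  rewrite (sw_antipodel (f := fun u => u * S (a * z))); last by lin.
  by rewrite mul1r.
by rewrite (sw_counitl (f := fun z => S (a * z))) //; lin.
Qed.


Definition group_like (a : H) := comult a = pure a a /\ counit a = 1.

(* The elements g making (H, g) a pivotal Hopf algebra. *)
Record pivotal := Pivotal {
  pivot :> H;
  pivot_group_like : group_like pivot;
  pivot_antipode2 : forall a, S (S a) = pivot * a * pivot^-1 }.

Lemma pivot_unit (g : pivotal) : (g : H) \is a GRing.unit.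
Proof.
have [gD ge] := pivot_group_like g.
apply/unitrP; exists (S (g : H)); split.
  by have := antipodel (g : H); rewrite gD ge scale1r tliftE //; lin.
by have := antipoder (g : H); rewrite gD ge scale1r tliftE //; lin.
Qed.

End HopfTheory.

Section Modules.
Variables (K : fieldType) (H : hopfAlgType K).
Notation triv := (triv K).
Notation S := (antipode : 'End(H)).

Lemma sw_app (U V : vectType K) (a : H) (E : H -> H -> 'Hom(U, V)) u :
  (sw a E) u = \sw_(x, y <- a) E x y u.
Proof. by rewrite (@sw_push _ _ _ _ a (fun h : 'Hom(U, V) => h u)) //; lin. Qed.

Lemma linfunE (U V : vectType K) (f : U -> V) : linear f -> linfun f =1 f.
Proof.
move=> lf; pose h := GRing.isLinear.Build K U V *:%R f lf.
pose F : {linear U -> V} := HB.pack f h.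
exact: (lfunE F).
Qed.

Lemma tmapl_lin (U U' V V' : vectType K) (g : 'Hom(V, V')) :
  linear (fun f : 'Hom(U, U') => tmap f g).
Proof.
move=> k f f'; apply: tens_eq => u v; rewrite add_lfunE scale_lfunE !tmapE.
by rewrite add_lfunE scale_lfunE pure_linl.
Qed.

Lemma tmapr_lin (U U' V V' : vectType K) (f : 'Hom(U, U')) :
  linear (fun g : 'Hom(V, V') => tmap f g).
Proof.
move=> k g g'; apply: tens_eq => u v; rewrite add_lfunE scale_lfunE !tmapE.
by rewrite add_lfunE scale_lfunE pure_linr.
Qed.

Lemma lin_tmapl (X U U' V V' : vectType K) (g : 'Hom(V, V')) (f : X -> 'Hom(U, U')) :
  linear f -> linear (fun x => tmap (f x) g).
Proof. exact: lin_comp (tmapl_lin g). Qed.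

Lemma lin_tmapr (X U U' V V' : vectType K) (g : 'Hom(V, V')) (f : X -> 'Hom(U, U')) :
  linear f -> linear (fun x => tmap g (f x)).
Proof. exact: lin_comp (tmapr_lin g). Qed.

Record hmod := HMod {
  hspace :> vectType K;
  hact : H -> 'End(hspace);
  hact_lin : linear hact;
  hact1 : hact 1 = \1%VF;
  hactM : forall a b, hact (a * b) = (hact a \o hact b)%VF }.

Implicit Types M N L P V W : hmod.

Lemma lin_hact M (X : vectType K) (f : X -> H) :
  linear f -> linear (fun x => hact M (f x)).
Proof. exact: lin_comp (@hact_lin M). Qed.

Ltac lin1' := first [lin1 | apply lin_hact | apply lin_tmapl | apply lin_tmapr].
Ltac lin ::= simpl; intros; repeat (lin1'; simpl; intros).

Definition hcomm_def M N (f : 'Hom(M, N)) : 'Hom(H, 'Hom(M, N)) :=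
  linfun (fun a => ((f \o hact M a) - (hact N a \o f))%VF).

Lemma hcommE M N (f : 'Hom(M, N)) a :
  hcomm_def f a = ((f \o hact M a) - (hact N a \o f))%VF.
Proof.
rewrite linfunE // => k x y; rewrite !hact_lin.
rewrite comp_lfunDr comp_lfunDl -comp_lfunZr -comp_lfunZl.
by rewrite scalerBr opprD addrACA.
Qed.

Lemma hcomm_lin M N : linear (@hcomm_def M N).
Proof.
move=> k f f'; apply/lfunP=> a; rewrite add_lfunE scale_lfunE !hcommE.
rewrite comp_lfunDr comp_lfunDl -comp_lfunZr -comp_lfunZl.
by rewrite scalerBr opprD addrACA.
Qed.

(* Hom_H(M, N), as a subspace of the K-linear maps: see homHP. *)
Definition homH M N : {vspace 'Hom(M, N)} := lker (linfun (@hcomm_def M N)).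

Lemma homHP M N (f : 'Hom(M, N)) :
  (forall a v, f (hact M a v) = hact N a (f v)) <-> f \in homH M N.
Proof.
rewrite memv_ker linfunE; last exact: hcomm_lin.
split=> [fH | /eqP f0 a v].
  apply/eqP/lfunP=> a; rewrite hcommE zero_lfunE; apply/lfunP=> v.
  by rewrite add_lfunE opp_lfunE !comp_lfunE fH subrr zero_lfunE.
move/lfunP/(_ a): f0; rewrite hcommE zero_lfunE => /lfunP/(_ v).
by rewrite add_lfunE opp_lfunE !comp_lfunE zero_lfunE => /subr0_eq.
Qed.

Definition hhom M N := subvs_of (homH M N).
HB.instance Definition _ M N := Vector.on (hhom M N).

Definition hfun M N (f : hhom M N) : 'Hom(M, N) := vsval f.
Coercion hfun : hhom >-> hom.

Definition mkhom M N (f : 'Hom(M, N))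
    (fH : forall a v, f (hact M a v) = hact N a (f v)) : hhom M N :=
  Subvs (proj1 (homHP f) fH).

Lemma hfunE M N (f : hhom M N) a v : f (hact M a v) = hact N a (f v).
Proof. exact: (proj2 (homHP f) (subvsP f)). Qed.

Lemma hhom_eq M N (f f' : hhom M N) : (forall v, f v = f' v) -> f = f'.
Proof. by move=> ff'; apply/val_inj/lfunP. Qed.

Fact hid_subproof M a v : (\1%VF : 'End(M)) (hact M a v) = hact M a ((\1%VF : 'End(M)) v).
Proof. by rewrite !id_lfunE. Qed.
Definition hid M : hhom M M := mkhom (@hid_subproof M).

Fact hcomp_subproof M N L (f : hhom N L) (f' : hhom M N) a v :
  (f \o f')%VF (hact M a v) = hact L a ((f \o f')%VF v).
Proof. by rewrite !comp_lfunE !hfunE. Qed.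
Definition hcomp M N L (f : hhom N L) (f' : hhom M N) : hhom M L :=
  mkhom (hcomp_subproof f f').

Lemma hcompE M N L (f : hhom N L) (f' : hhom M N) v : hcomp f f' v = f (f' v).
Proof. exact: comp_lfunE. Qed.

Definition hunit_act (a : H) : 'End(triv) := counit a *: \1%VF.
Fact hunit_lin : linear hunit_act.
Proof. by apply: lin_scalel; exact: linearP. Qed.
Fact hunit_act1 : hunit_act 1 = \1%VF.
Proof. by rewrite /hunit_act rmorph1 scale1r. Qed.
Fact hunit_actM a b : hunit_act (a * b) = (hunit_act a \o hunit_act b)%VF.
Proof.
by rewrite /hunit_act rmorphM -comp_lfunZr -comp_lfunZl comp_lfun1l scalerA mulrC.
Qed.
Definition hunit : hmod := HMod hunit_lin hunit_act1 hunit_actM.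

Fact hreg_lin : linear (fun a : H => amull a).
Proof. exact: linearP. Qed.
Fact hreg_act1 : amull (1 : H) = \1%VF.
Proof. by apply/lfunP=> x; rewrite !lfunE /= mul1r. Qed.
Fact hreg_actM (a b : H) : amull (a * b) = (amull a \o amull b)%VF.
Proof. by apply/lfunP=> x; rewrite comp_lfunE !lfunE /= mulrA. Qed.
Definition hreg : hmod := HMod hreg_lin hreg_act1 hreg_actM.

(* (a . xi)(v) = xi (S(a) v) *)
Definition hdual_act M (a : H) : 'End(dual M) :=
  linfun (fun xi : dual M => (xi \o hact M (S a))%VF).
Lemma hdual_actE M a xi : hdual_act M a xi = (xi \o hact M (S a))%VF.
Proof. by rewrite /hdual_act linfunE //; lin. Qed.
Fact hdual_lin M : linear (@hdual_act M).
Proof.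
move=> k a b; apply/lfunP=> xi; rewrite add_lfunE scale_lfunE !hdual_actE.
by rewrite linearP hact_lin comp_lfunDr -comp_lfunZr.
Qed.
Fact hdual_act1 M : hdual_act M 1 = \1%VF.
Proof.
by apply/lfunP=> xi; rewrite hdual_actE antipode1 hact1 comp_lfun1r id_lfunE.
Qed.
Fact hdual_actM M a b : hdual_act M (a * b) = (hdual_act M a \o hdual_act M b)%VF.
Proof.
apply/lfunP=> xi; rewrite comp_lfunE !hdual_actE antipodeM hactM.
by rewrite comp_lfunA.
Qed.
Definition hdual M : hmod := HMod (@hdual_lin M) (hdual_act1 M) (@hdual_actM M).

(* a . (v (x) w) = a_(1) v (x) a_(2) w *)
Definition htens_act M N (a : H) : 'End(tens M N) :=
  \sw_(x, y <- a) tmap (hact M x) (hact N y).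
Lemma htens_actE M N a v w :
  htens_act M N a (pure v w) = \sw_(x, y <- a) pure (hact M x v) (hact N y w).
Proof. by rewrite /htens_act sw_app; apply: eq_sw => x y; rewrite tmapE. Qed.
Fact htens_lin M N : linear (@htens_act M N).
Proof. by rewrite /htens_act; lin. Qed.
Fact htens_act1 M N : htens_act M N 1 = \1%VF.
Proof.
apply: tens_eq => v w; rewrite htens_actE sw1; [|by lin..].
by rewrite !hact1 !id_lfunE.
Qed.
Fact htens_actM M N a b :
  htens_act M N (a * b) = (htens_act M N a \o htens_act M N b)%VF.
Proof.
apply: tens_eq => v w; rewrite comp_lfunE !htens_actE swM; [|by lin..].
rewrite sw_hom sw_exchange; apply: eq_sw => x y.
by rewrite htens_actE; apply: eq_sw => x' y'; rewrite !hactM !comp_lfunE.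
Qed.
Definition htens M N : hmod :=
  HMod (@htens_lin M N) (htens_act1 M N) (@htens_actM M N).

Lemma htensE M N a (v : M) (w : N) : hact (htens M N) a (pure v w) =
  \sw_(x, y <- a) pure (hact M x v) (hact N y w).
Proof. exact: htens_actE. Qed.

Section Twist.
Variable phi : {lrmorphism H -> H}.
Definition twist_act M (a : H) := hact M (phi a).
Fact twist_lin M : linear (@twist_act M).
Proof. by move=> k a b; rewrite /twist_act linearP hact_lin. Qed.
Fact twist_act1 M : twist_act M 1 = \1%VF.
Proof. by rewrite /twist_act rmorph1 hact1. Qed.
Fact twist_actM M a b : twist_act M (a * b) = (twist_act M a \o twist_act M b)%VF.
Proof. by rewrite /twist_act rmorphM hactM. Qed.
Definition twist M : hmod := HMod (@twist_lin M) (twist_act1 M) (@twist_actM M).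

Fact twisth_subproof M N (f : hhom M N) a v :
  (f : 'Hom(M, N)) (hact (twist M) a v) = hact (twist N) a (f v).
Proof. exact: hfunE. Qed.
Definition twisth M N (f : hhom M N) : hhom (twist M) (twist N) :=
  @mkhom (twist M) (twist N) f (twisth_subproof f).
End Twist.


Lemma tens_hom M N L (f : 'Hom(tens M N, L)) :
  (forall a v w, f (\sw_(x, y <- a) pure (hact M x v) (hact N y w))
     = hact L a (f (pure v w))) ->
  forall a T, f (hact (htens M N) a T) = hact L a (f T).
Proof.
move=> fP a T; rewrite -!comp_lfunE; congr (fun_of_lfun _ T).
by apply: tens_eq => v w; rewrite !comp_lfunE -fP htensE.
Qed.

Fact htmap_subproof M M' N N' (f : hhom M M') (f' : hhom N N') a T :
  tmap f f' (hact (htens M N) a T) = hact (htens M' N') a (tmap f f' T).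
Proof.
apply: (tens_hom (L := htens M' N')) a T => a v w; rewrite sw_hom tmapE htensE.
by apply: eq_sw => x y; rewrite tmapE !hfunE.
Qed.
Definition htmap M M' N N' (f : hhom M M') (f' : hhom N N') :
  hhom (htens M N) (htens M' N') :=
  @mkhom (htens M N) (htens M' N') (tmap f f') (htmap_subproof f f').

Lemma tens_eq3 (U V W X : vectType K) (f f' : 'Hom(tens (tens U V) W, X)) :
  (forall u v w, f (pure (pure u v) w) = f' (pure (pure u v) w)) -> f = f'.
Proof.
move=> ff'; apply: tens_eq => T w.
rewrite -(linfunE (pure_linl w) T) -!comp_lfunE; congr (fun_of_lfun _ T).
by apply: tens_eq => u v; rewrite !comp_lfunE linfunE //; exact: pure_linl.
Qed.

Lemma tens_eq3' (U V W X : vectType K) (f f' : 'Hom(tens U (tens V W), X)) :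
  (forall u v w, f (pure u (pure v w)) = f' (pure u (pure v w))) -> f = f'.
Proof.
move=> ff'; apply: tens_eq => u T.
rewrite -(linfunE (pure_linr u) T) -!comp_lfunE; congr (fun_of_lfun _ T).
by apply: tens_eq => v w; rewrite !comp_lfunE linfunE //; exact: pure_linr.
Qed.

Fact hassoc_subproof M N L a T :
  tassoc M N L (hact (htens (htens M N) L) a T)
    = hact (htens M (htens N L)) a (tassoc M N L T).
Proof.
rewrite -!comp_lfunE; congr (fun_of_lfun _ T).
apply: tens_eq3 => u v w; rewrite !comp_lfunE tassocE.
rewrite (@htensE (htens M N) L) (@htensE M (htens N L)) sw_hom.
transitivity (\sw_(x, z <- a) \sw_(x', y <- x)
    pure (hact M x' u) (pure (hact N y v) (hact L z w))).
  apply: eq_sw => x z; rewrite htensE.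
  rewrite (@sw_push _ _ _ _ x (fun T => tassoc M N L (pure T _))); last by lin.
  by apply: eq_sw => x' y; rewrite tassocE.
rewrite swA; [|by lin..]; apply: eq_sw => x y.
by rewrite htensE (sw_push _ _ (pure_linr _)).
Qed.
Definition hassoc M N L : hhom (htens (htens M N) L) (htens M (htens N L)) :=
  @mkhom (htens (htens M N) L) (htens M (htens N L)) _ (@hassoc_subproof M N L).

Lemma tassocK (U V W : vectType K) : (tassocV U V W \o tassoc U V W)%VF = \1%VF.
Proof. by apply: tens_eq3 => u v w; rewrite comp_lfunE tassocE tassocVE id_lfunE. Qed.

Lemma tassocVK (U V W : vectType K) : (tassoc U V W \o tassocV U V W)%VF = \1%VF.
Proof. by apply: tens_eq3' => u v w; rewrite comp_lfunE tassocVE tassocE id_lfunE. Qed.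

Fact hassocV_subproof M N L a T :
  tassocV M N L (hact (htens M (htens N L)) a T)
    = hact (htens (htens M N) L) a (tassocV M N L T).
Proof.
have VK X : tassoc M N L (tassocV M N L X) = X.
  by rewrite -comp_lfunE tassocVK id_lfunE.
have KV X : tassocV M N L (tassoc M N L X) = X.
  by rewrite -comp_lfunE tassocK id_lfunE.
by rewrite -{1}[T]VK -hassoc_subproof KV.
Qed.
Definition hassocV M N L : hhom (htens M (htens N L)) (htens (htens M N) L) :=
  @mkhom (htens M (htens N L)) (htens (htens M N) L) _ (@hassocV_subproof M N L).

Definition trunit (V : vectType K) : 'Hom(tens V triv, V) :=
  tlift (fun v (c : triv) => (c : K) *: v).
Lemma trunitE (V : vectType K) (v : V) (c : triv) : trunit V (pure v c) = (c : K) *: v.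
Proof. by rewrite /trunit tliftE // => u; [apply: lin_scaler | apply: lin_scalel]. Qed.
Fact hrunit_subproof M a T :
  trunit M (hact (htens M (hunit)) a T) = hact M a (trunit M T).
Proof.
apply: (tens_hom (L := M)) a T => a v c; rewrite sw_hom trunitE linearZ /=.
rewrite -(sw_counitr (f := fun x => hact M x v)); last by lin.
rewrite -sw_scale; apply: eq_sw => x y.
by rewrite trunitE scale_lfunE id_lfunE scalerA mulrC.
Qed.
Definition hrunit M : hhom (htens M hunit) M :=
  @mkhom (htens M hunit) M _ (@hrunit_subproof M).

Definition trunitV (V : vectType K) : 'Hom(V, tens V triv) :=
  linfun (fun v => pure v (1 : triv)).
Lemma trunitVE (V : vectType K) (v : V) : trunitV V v = pure v (1 : triv).
Proof. exact: linfunE (pure_linl _) _. Qed.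
Fact hrunitV_subproof M a v :
  trunitV M (hact M a v) = hact (htens M hunit) a (trunitV M v).
Proof.
rewrite !trunitVE htensE -(sw_counitr (f := fun x => hact M x v)); last by lin.
rewrite (sw_push _ _ (pure_linl _)); apply: eq_sw => x y.
rewrite /= scale_lfunE id_lfunE (linD (pure_linl _)) -(linD (pure_linr _)).
by [].
Qed.
Definition hrunitV M : hhom M (htens M hunit) :=
  @mkhom M (htens M hunit) _ (@hrunitV_subproof M).

Definition tlunit (V : vectType K) : 'Hom(tens triv V, V) :=
  tlift (fun (c : triv) v => (c : K) *: v).
Lemma tlunitE (V : vectType K) (v : V) (c : triv) : tlunit V (pure c v) = (c : K) *: v.
Proof. by rewrite /tlunit tliftE // => u; [apply: lin_scalel | apply: lin_scaler]. Qed.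
Fact hlunit_subproof M a T :
  tlunit M (hact (htens hunit M) a T) = hact M a (tlunit M T).
Proof.
apply: (tens_hom (L := M)) a T => a c v; rewrite sw_hom tlunitE linearZ /=.
rewrite -(sw_counitl (f := fun x => hact M x v)); last by lin.
rewrite -sw_scale; apply: eq_sw => x y.
by rewrite tlunitE scale_lfunE id_lfunE scalerA mulrC.
Qed.
Definition hlunit M : hhom (htens hunit M) M :=
  @mkhom (htens hunit M) M _ (@hlunit_subproof M).

Definition tlunitV (V : vectType K) : 'Hom(V, tens triv V) :=
  linfun (fun v => pure (1 : triv) v).
Lemma tlunitVE (V : vectType K) (v : V) : tlunitV V v = pure (1 : triv) v.
Proof. exact: linfunE (pure_linr _) _. Qed.
Fact hlunitV_subproof M a v :
  tlunitV M (hact M a v) = hact (htens hunit M) a (tlunitV M v).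
Proof.
rewrite !tlunitVE htensE -(sw_counitl (f := fun x => hact M x v)); last by lin.
rewrite (sw_push _ _ (pure_linr _)); apply: eq_sw => x y.
by rewrite /= scale_lfunE id_lfunE (linD (pure_linr _)) -(linD (pure_linl _)).
Qed.
Definition hlunitV M : hhom M (htens hunit M) :=
  @mkhom M (htens hunit M) _ (@hlunitV_subproof M).

Definition tev (V : vectType K) : 'Hom(tens (dual V) V, triv) :=
  tlift (fun (xi : dual V) v => xi v).
Lemma tevE (V : vectType K) (xi : dual V) v : tev V (pure xi v) = xi v.
Proof. by rewrite /tev tliftE //; lin. Qed.
Fact hev_subproof M a T :
  tev M (hact (htens (hdual M) M) a T) = hact hunit a (tev M T).
Proof.
apply: (tens_hom (L := hunit)) a T => a xi v; rewrite sw_hom tevE.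
rewrite scale_lfunE id_lfunE -[v in RHS]id_lfunE -(hact1 M).
rewrite -(sw_antipodel (f := fun z => xi (hact M z v))); last by lin.
apply: eq_sw => x y; rewrite tevE /= hdual_actE comp_lfunE hactM comp_lfunE.
by [].
Qed.
Definition hev M : hhom (htens (hdual M) M) hunit :=
  @mkhom (htens (hdual M) M) hunit _ (@hev_subproof M).

Lemma bcovecE (V : vectType K) i v : @bcovec K V i v = coord (vbasis {:V}) i v.
Proof. by rewrite lfunE. Qed.

Lemma casimir_slide (V W : vectType K) (f : 'Hom(V, W)) (h : 'End(V)) :
  \sum_i pure (f (bvec i)) (bcovec i \o h)%VF
    = \sum_i pure (f (h (bvec i))) (@bcovec K V i).
Proof.
have hE i : (bcovec i \o h)%VF = \sum_j (bcovec i (h (bvec j)) : K) *: @bcovec K V j.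
  apply/lfunP=> v; rewrite comp_lfunE {1}[v]bvecE linear_sum linear_sum sum_lfunE.
  apply: eq_bigr => j _; rewrite !linearZ scale_lfunE !bcovecE.
  rewrite /= (bcovecE i); exact: mulrC (coord _ j v : K) _.
under eq_bigr => i _ do rewrite hE (linS (pure_linr _)).
rewrite exchange_big /=; apply: eq_bigr => j _.
rewrite [h (bvec j) in RHS]bvecE linear_sum (linS (pure_linl _)).
apply: eq_bigr => i _.
by rewrite (linD (pure_linr _)) linearZ /= (linD (pure_linl _)) bcovecE.
Qed.

Definition tcoev (V : vectType K) : 'Hom(triv, tens V (dual V)) :=
  linfun (fun c : triv => (c : K) *: \sum_i pure (bvec i) (@bcovec K V i)).
Lemma tcoevE (V : vectType K) (c : triv) :
  tcoev V c = (c : K) *: \sum_i pure (bvec i) (@bcovec K V i).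
Proof. by rewrite /tcoev linfunE //; apply: lin_scalel. Qed.
Fact hcoev_subproof M a c :
  tcoev M (hact hunit a c) = hact (htens M (hdual M)) a (tcoev M c).
Proof.
rewrite !tcoevE linearZ /= scale_lfunE id_lfunE [_ *: c]mulrC -scalerA; congr (_ *: _).
rewrite [RHS](linS (linearP _)); under [RHS]eq_bigr => i _ do
  rewrite /= (@htens_actE M (hdual M)).
rewrite /sw -tlift_sum.
transitivity (\sw_(x, y <- a) \sum_i pure (hact M (x * S y) (bvec i)) (@bcovec K M i)).
  rewrite (sw_antipoder (f := fun z => \sum_i pure (hact M z (bvec i)) (bcovec i))).
    by rewrite hact1; under [in RHS]eq_bigr do rewrite id_lfunE.
  by lin.
apply: eq_sw => x y; under [RHS]eq_bigr => i _ do rewrite /= hdual_actE.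
by rewrite casimir_slide; apply: eq_bigr => i _; rewrite hactM comp_lfunE.
Qed.
Definition hcoev M : hhom hunit (htens M (hdual M)) :=
  @mkhom hunit (htens M (hdual M)) _ (@hcoev_subproof M).

Section Pivotal.
Variable g : pivotal H.

Definition tevt M : 'Hom(tens M (dual M), triv) :=
  tlift (fun v (xi : dual M) => xi (hact M g v)).
Lemma tevtE M (xi : dual M) v : tevt M (pure v xi) = xi (hact M g v).
Proof. by rewrite /tevt tliftE //; lin. Qed.
Fact hevt_subproof M a T :
  tevt M (hact (htens M (hdual M)) a T) = hact hunit a (tevt M T).
Proof.
apply: (tens_hom (L := hunit)) a T => a v xi; rewrite sw_hom tevtE.
transitivity (\sw_(x, y <- a) xi (hact M (S (S x * y) * (g : H)) v)).
  apply: eq_sw => x y; rewrite tevtE /= hdual_actE comp_lfunE.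
  congr (fun_of_lfun xi _); rewrite -!comp_lfunE -!hactM.
  by rewrite antipodeM (pivot_antipode2 g) -!mulrA mulVr ?pivot_unit // mulr1.
rewrite (sw_antipodel (f := fun z => xi (hact M (S z * (g : H)) v))); last by lin.
by rewrite antipode1 mul1r /= scale_lfunE id_lfunE.
Qed.
Definition hevt M : hhom (htens M (hdual M)) hunit :=
  @mkhom (htens M (hdual M)) hunit _ (@hevt_subproof M).

Definition tcoevt M : 'Hom(triv, tens (dual M) M) :=
  linfun (fun c : triv =>
    (c : K) *: \sum_i pure (@bcovec K M i) (hact M (g : H)^-1 (bvec i))).
Lemma tcoevtE M (c : triv) : tcoevt M c =
  (c : K) *: \sum_i pure (@bcovec K M i) (hact M (g : H)^-1 (bvec i)).
Proof. by rewrite /tcoevt linfunE //; apply: lin_scalel. Qed.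
Lemma casimir_slide' (V W : vectType K) (f : 'Hom(V, W)) (h : 'End(V)) :
  \sum_i pure (bcovec i \o h)%VF (f (bvec i))
    = \sum_i pure (@bcovec K V i) (f (h (bvec i))).
Proof.
pose F : 'Hom(tens W (dual V), tens (dual V) W) := tlift (fun w xi => pure xi w).
have FE w xi : F (pure w xi) = pure xi w.
  by rewrite tliftE // => u; [exact: pure_linr | exact: pure_linl].
have /(congr1 F) := casimir_slide f h.
rewrite !(linS (linearP F)) (eq_bigr _ (fun i _ => FE _ _)) => ->.
by apply: eq_bigr => i _; exact: FE.
Qed.
Fact hcoevt_subproof M a c :
  tcoevt M (hact hunit a c) = hact (htens (hdual M) M) a (tcoevt M c).
Proof.
rewrite !tcoevtE linearZ /= scale_lfunE id_lfunE [_ *: c]mulrC -scalerA; congr (_ *: _).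
rewrite [RHS](linS (linearP _)); under [RHS]eq_bigr => i _ do
  rewrite /= (@htens_actE (hdual M) M).
rewrite /sw -tlift_sum.
transitivity (\sw_(x, y <- a)
    \sum_i pure (@bcovec K M i) (hact M ((g : H)^-1 * S (x * S y)) (bvec i))).
  rewrite (sw_antipoder (f := fun z =>
    \sum_i pure (bcovec i) (hact M ((g : H)^-1 * S z) (bvec i)))) ?antipode1 ?mulr1 //.
  by lin.
apply: eq_sw => x y; under [RHS]eq_bigr => i _ do rewrite /= hdual_actE -comp_lfunE.
rewrite casimir_slide'; apply: eq_bigr => i _; rewrite -!comp_lfunE -!hactM.
by rewrite antipodeM (pivot_antipode2 g) !mulrA mulVr ?pivot_unit // mul1r.
Qed.
Definition hcoevt M : hhom hunit (htens (hdual M) M) :=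
  @mkhom hunit (htens (hdual M) M) _ (@hcoevt_subproof M).
End Pivotal.


(* The lifting property is tested in H-mod: since H is finite-dimensional, this *)
(* is equivalent to projectivity among all H-modules.                           *)
Definition projective P : Prop :=
  forall M N (p : hhom M N) (f : hhom P N),
    (forall y : N, exists x : M, p x = y) -> exists h : hhom P M, hcomp p h = f.

Record pmod := PMod { pmod_mod :> hmod; pmodP : projective pmod_mod }.

Lemma hreg_projective : projective hreg.
Proof.
move=> M N p f p_surj; have [x px] := p_surj (f (1 : H)).
pose h : 'Hom(hreg, M) := linfun (fun a : H => hact M a x).
have hE a : h a = hact M a x by rewrite linfunE //; lin.
have hH a b : h (hact hreg a b) = hact M a (h b).
  by rewrite !hE -comp_lfunE -hactM /= lfunE.
exists (mkhom hH); apply: hhom_eq => a; rewrite hcompE /hfun /= hE.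
by rewrite [LHS](hfunE p) px -(hfunE f) /= lfunE /= mulr1.
Qed.

Lemma bcovec_sum (V : vectType K) (v : V) :
  \sum_i ((@bcovec K V i) v : K) *: bvec i = v.
Proof. by rewrite [RHS]bvecE; apply: eq_bigr => i _; rewrite bcovecE. Qed.

Lemma surj_section (V W : vectType K) (p : 'Hom(V, W)) :
  (forall y, exists x, p x = y) -> exists q : 'Hom(W, V), (p \o q)%VF = \1%VF.
Proof.
move=> p_surj; exists (p^-1)%VF; apply/lfunP=> y; rewrite comp_lfunE id_lfunE.
by have [x <-] := p_surj y; rewrite limg_lfunVK // memv_img ?memvf.
Qed.

Lemma hhom_tens_eq M N L (f f' : hhom (htens M N) L) :
  (forall v w, f (pure v w) = f' (pure v w)) -> f = f'.
Proof. by move=> ff'; apply/val_inj; apply: tens_eq. Qed.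

Lemma htens_projective P V : projective P -> projective (htens P V).
Proof.
move=> P_proj M N p f p_surj.
pose f1 : hhom P (htens N (hdual V)) :=
  hcomp (htmap f (hid (hdual V))) (hcomp (hassocV P V (hdual V))
    (hcomp (htmap (hid P) (hcoev V)) (hrunitV P))).
have [q qP] := surj_section p_surj.
have pV_surj (y : htens N (hdual V)) :
    exists x : htens M (hdual V), htmap p (hid (hdual V)) x = y.
  exists (tmap q \1%VF y); rewrite -comp_lfunE -[RHS]id_lfunE; congr (fun_of_lfun _ y).
  apply: tens_eq => n xi; rewrite comp_lfunE tmapE [LHS]tmapE !id_lfunE.
  by rewrite -comp_lfunE qP id_lfunE.
have [h1 h1P] := P_proj _ _ _ f1 pV_surj.
pose k L : hhom (htens (htens L (hdual V)) V) L :=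
  hcomp (hrunit L) (hcomp (htmap (hid L) (hev V)) (hassoc L (hdual V) V)).
have kE (L : hmod) (l : L) (xi : dual V) (v : V) :
    k L (pure (pure l xi) v) = ((xi : 'Hom(V, triv)) v : K) *: l.
  rewrite !hcompE [hassoc _ _ _ _]tassocE [htmap _ _ _]tmapE [hev V _]tevE.
  by rewrite [LHS]trunitE id_lfunE.
exists (hcomp (k M) (htmap h1 (hid V))).
apply: hhom_tens_eq => x v.
rewrite 2!hcompE [htmap _ _ _]tmapE [X in pure _ X]id_lfunE.
have pk (T : htens M (hdual V)) : p (k M (pure T v)) =
    k N (pure (htmap p (hid (hdual V)) T) v).
  pose F : 'Hom(tens M (dual V), N) := linfun (fun T => p (k M (pure T v))).
  pose G : 'Hom(tens M (dual V), N) :=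
    linfun (fun T => k N (pure (htmap p (hid (hdual V)) T) v)).
  have FE T' : F T' = p (k M (pure T' v)) by apply: linfunE; lin.
  have GE T' : G T' = k N (pure (htmap p (hid (hdual V)) T') v).
    by apply: linfunE; lin.
  rewrite -FE -GE; congr (fun_of_lfun _ T); apply: tens_eq => m xi.
  by rewrite FE GE [htmap _ _ _]tmapE !kE linearZ id_lfunE.
have f1E : f1 x = \sum_i pure (f (pure x (bvec i))) (@bcovec K V i).
  rewrite !hcompE [hrunitV P x]trunitVE [htmap (hid P) _ _]tmapE.
  rewrite id_lfunE [hcoev V _]tcoevE scale1r.
  rewrite (@linS _ _ _ (fun T => htmap f (hid (hdual V))
    (hassocV P V (hdual V) (pure x T)))); last by lin.
  apply: eq_bigr => i _; rewrite [hassocV _ _ _ _]tassocVE [htmap _ _ _]tmapE.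
  by rewrite id_lfunE.
rewrite pk -hcompE h1P f1E (@linS _ _ _ (fun T => k N (pure T v))); last by lin.
rewrite (eq_bigr _ (fun i _ => kE _ _ _ _)) -{2}[v]bcovec_sum.
rewrite (@linS _ _ _ (fun u => f (pure x u))); last by lin.
apply: eq_bigr => i _; rewrite (linD (f := fun u => f (pure x u))) //; lin.
Qed.

Lemma htensl_projective (g : pivotal H) V P : projective P -> projective (htens V P).
Proof.
move=> P_proj M N p f p_surj.
pose f1 : hhom P (htens (hdual V) N) :=
  hcomp (htmap (hid (hdual V)) f) (hcomp (hassoc (hdual V) V P)
    (hcomp (htmap (hcoevt g V) (hid P)) (hlunitV P))).
have [q qP] := surj_section p_surj.
have pV_surj (y : htens (hdual V) N) :
    exists x : htens (hdual V) M, htmap (hid (hdual V)) p x = y.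
  exists (tmap \1%VF q y); rewrite -comp_lfunE -[RHS]id_lfunE; congr (fun_of_lfun _ y).
  apply: tens_eq => xi n; rewrite comp_lfunE tmapE [LHS]tmapE !id_lfunE.
  by rewrite -comp_lfunE qP id_lfunE.
have [h1 h1P] := P_proj _ _ _ f1 pV_surj.
pose k L : hhom (htens V (htens (hdual V) L)) L :=
  hcomp (hlunit L) (hcomp (htmap (hevt g V) (hid L)) (hassocV V (hdual V) L)).
have kE (L : hmod) (l : L) (xi : dual V) (v : V) :
    k L (pure v (pure xi l)) = ((xi : 'Hom(V, triv)) (hact V g v) : K) *: l.
  rewrite !hcompE [hassocV _ _ _ _]tassocVE [htmap _ _ _]tmapE [hevt g V _]tevtE.
  by rewrite [LHS]tlunitE id_lfunE.
exists (hcomp (k M) (htmap (hid V) h1)).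
apply: hhom_tens_eq => v x.
rewrite 2!hcompE [htmap _ _ _]tmapE [X in pure X _]id_lfunE.
have pk (T : htens (hdual V) M) : p (k M (pure v T)) =
    k N (pure v (htmap (hid (hdual V)) p T)).
  pose F : 'Hom(tens (dual V) M, N) := linfun (fun T => p (k M (pure v T))).
  pose G : 'Hom(tens (dual V) M, N) :=
    linfun (fun T => k N (pure v (htmap (hid (hdual V)) p T))).
  have FE T' : F T' = p (k M (pure v T')) by apply: linfunE; lin.
  have GE T' : G T' = k N (pure v (htmap (hid (hdual V)) p T')).
    by apply: linfunE; lin.
  rewrite -FE -GE; congr (fun_of_lfun _ T); apply: tens_eq => xi m.
  by rewrite FE GE [htmap _ _ _]tmapE !kE linearZ id_lfunE.
have f1E : f1 x =
    \sum_i pure (@bcovec K V i) (f (pure (hact V (g : H)^-1 (bvec i)) x)).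
  rewrite !hcompE [hlunitV P x]tlunitVE [htmap (hcoevt g V) _ _]tmapE.
  rewrite id_lfunE [hcoevt g V _]tcoevtE scale1r.
  rewrite (@linS _ _ _ (fun T => htmap (hid (hdual V)) f
    (hassoc (hdual V) V P (pure T x)))); last by lin.
  apply: eq_bigr => i _; rewrite [hassoc _ _ _ _]tassocE [htmap _ _ _]tmapE.
  by rewrite id_lfunE.
rewrite pk -hcompE h1P f1E (@linS _ _ _ (fun T => k N (pure v T))); last by lin.
have {2}-> : v = hact V (g : H)^-1 (hact V g v).
  by rewrite -comp_lfunE -hactM mulVr ?pivot_unit // hact1 id_lfunE.
rewrite (eq_bigr _ (fun i _ => kE _ _ _ _)) -{2}[hact V g v]bcovec_sum.
rewrite (@linS _ _ _ (fun u => f (pure (hact V (g : H)^-1 u) x))); last by lin.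
apply: eq_bigr => i _.
by rewrite (linD (f := fun u => f (pure (hact V (g : H)^-1 u) x))) //; lin.
Qed.

Definition preg : pmod := PMod hreg_projective.
Definition ptensr (P : pmod) V : pmod := PMod (@htens_projective P V (@pmodP P)).
Definition ptensl (g : pivotal H) V (P : pmod) : pmod :=
  PMod (@htensl_projective g V P (@pmodP P)).

End Modules.

Notation "f '\oh' g" := (hcomp f g) (at level 40, left associativity).

Section Traces.
Variables (K : fieldType) (H : hopfAlgType K) (g : pivotal H).
Implicit Types (V M : hmod H) (P : pmod H).

(* Algebra endomorphisms phi of H such that                                   *)
(* phi_*(P (x) V) = phi_*(P) (x) V, resp. phi_*(V (x) P) = V (x) phi_*(P).    *)
Record right_twist := RightTwist {
  rtw :> {lrmorphism H -> H};
  rtwP : forall a, comult (rtw a) = \sw_(x, y <- a) pure (rtw x) y }.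

Record left_twist := LeftTwist {
  ltw :> {lrmorphism H -> H};
  ltwP : forall a, comult (ltw a) = \sw_(x, y <- a) pure x (ltw y) }.

Fact id_rtwP a : comult (idfun a : H) = \sw_(x, y <- a) pure (idfun x : H) y.
Proof. exact: tpureE. Qed.
Definition rtw_id : right_twist := RightTwist id_rtwP.
Fact id_ltwP a : comult (idfun a : H) = \sw_(x, y <- a) pure x (idfun y : H).
Proof. exact: tpureE. Qed.
Definition ltw_id : left_twist := LeftTwist id_ltwP.

(* R(nu) = (nu (x) id) Delta and L(nu) = (id (x) nu) Delta, for a group-like  *)
(* functional nu, that is, an algebra map H -> K.                             *)
Section GroupLike.
Variable nu : {lrmorphism H -> K | *%R}.

Definition Rmap (a : H) : H := \sw_(x, y <- a) (nu x *: y).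
Definition Lmap (a : H) : H := \sw_(x, y <- a) (nu y *: x).

Let lin_nul (U V : vectType K) (f : U -> H) (v : V) :
  linear f -> linear (fun u => nu (f u) *: v).
Proof. by move=> lf; apply: lin_scalel => k x y /=; rewrite lf linearP. Qed.

Fact Rmap_linear : linear Rmap.
Proof. by apply: lin_swa; apply: lin_id. Qed.
Fact Lmap_linear : linear Lmap.
Proof. by apply: lin_swa; apply: lin_id. Qed.
HB.instance Definition _ := GRing.isLinear.Build K H H _ Rmap Rmap_linear.
HB.instance Definition _ := GRing.isLinear.Build K H H _ Lmap Lmap_linear.

Fact Rmap_monoid : monoid_morphism Rmap.
Proof.
split=> [|a b]; rewrite /Rmap.
  by rewrite sw1 ?rmorph1 ?scale1r // => u; [exact: lin_nul | exact: lin_scaler].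
rewrite (swM (t := fun x y => nu x *: y));
  [| by move=> u; exact: lin_nul | by move=> u; exact: lin_scaler].
rewrite (@sw_push _ _ _ _ a (fun u => u * _)); last by lin.
apply: eq_sw => x y; rewrite (@sw_push _ _ _ _ b (fun u => _ * u)); last by lin.
by apply: eq_sw => x' y'; rewrite rmorphM -scalerAl -scalerAr scalerA.
Qed.
Fact Lmap_monoid : monoid_morphism Lmap.
Proof.
split=> [|a b]; rewrite /Lmap.
  by rewrite sw1 ?rmorph1 ?scale1r // => u; [exact: lin_scaler | exact: lin_nul].
rewrite (swM (t := fun x y => nu y *: x));
  [| by move=> u; exact: lin_scaler | by move=> u; exact: lin_nul].
rewrite (@sw_push _ _ _ _ a (fun u => u * _)); last by lin.
apply: eq_sw => x y; rewrite (@sw_push _ _ _ _ b (fun u => _ * u)); last by lin.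
by apply: eq_sw => x' y'; rewrite rmorphM -scalerAl -scalerAr scalerA.
Qed.
HB.instance Definition _ := GRing.isMonoidMorphism.Build H H Rmap Rmap_monoid.
HB.instance Definition _ := GRing.isMonoidMorphism.Build H H Lmap Lmap_monoid.

Fact Rmap_twP a : comult (Rmap a) = \sw_(x, y <- a) pure (Rmap x) y.
Proof.
transitivity (\sw_(x, y <- a) \sw_(y', z <- y) (nu x *: pure y' z)).
  rewrite /Rmap sw_hom; apply: eq_sw => x y.
  by rewrite linearZ /= sw_scale {1}[comult y]tpureE.
rewrite -swA.
- apply: eq_sw => x y; rewrite /Rmap (sw_push _ _ (pure_linl _)).
  by apply: eq_sw => u v; rewrite (linD (pure_linl _)).
- by move=> y z; apply: lin_nul.
- by move=> x z; apply: lin_scaler; exact: pure_linl.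
- by move=> x z; apply: lin_scaler; exact: pure_linr.
Qed.
Fact Lmap_twP a : comult (Lmap a) = \sw_(x, y <- a) pure x (Lmap y).
Proof.
transitivity (\sw_(x, z <- a) \sw_(x', y <- x) (nu z *: pure x' y)).
  rewrite /Lmap sw_hom; apply: eq_sw => x y.
  by rewrite linearZ /= sw_scale {1}[comult x]tpureE.
rewrite swA.
- apply: eq_sw => x y; rewrite /Lmap (sw_push _ _ (pure_linr _)).
  by apply: eq_sw => u v; rewrite (linD (pure_linr _)).
- by move=> y z; apply: lin_scaler; exact: pure_linl.
- by move=> x z; apply: lin_scaler; exact: pure_linr.
- by move=> x z; apply: lin_nul.
Qed.
Definition rtw_R : right_twist := RightTwist Rmap_twP.
Definition ltw_L : left_twist := LeftTwist Lmap_twP.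
End GroupLike.

Fact rtw_cast_subproof (phi : right_twist) M (P V : hmod H)
    (f : hhom M (twist phi (htens P V))) a v :
  (f : 'Hom(M, tens P V)) (hact M a v) = hact (htens (twist phi P) V) a (f v).
Proof.
transitivity (hact (twist phi (htens _ _)) a (f v)); first exact: hfunE f a v.
rewrite /= /twist_act /= /htens_act {1}/sw rtwP; congr (fun_of_lfun _ (f v)).
rewrite tlift_sw; apply: eq_sw => x y.
by rewrite tliftE // => u; [apply: lin_tmapl | apply: lin_tmapr]; apply: hact_lin.
Qed.
(* f, viewed as a morphism to phi_*(P) (x) V = phi_*(P (x) V). *)
Definition rtw_cast (phi : right_twist) M (P V : hmod H)
    (f : hhom M (twist phi (htens P V))) : hhom M (htens (twist phi P) V) :=
  @mkhom _ _ M (htens (twist phi P) V) f (rtw_cast_subproof f).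

Fact ltw_cast_subproof (phi : left_twist) M (P V : hmod H)
    (f : hhom M (twist phi (htens V P))) a v :
  (f : 'Hom(M, tens V P)) (hact M a v) = hact (htens V (twist phi P)) a (f v).
Proof.
transitivity (hact (twist phi (htens _ _)) a (f v)); first exact: hfunE f a v.
rewrite /= /twist_act /= /htens_act {1}/sw ltwP; congr (fun_of_lfun _ (f v)).
rewrite tlift_sw; apply: eq_sw => x y.
by rewrite tliftE // => u; [apply: lin_tmapl | apply: lin_tmapr]; apply: hact_lin.
Qed.
Definition ltw_cast (phi : left_twist) M (P V : hmod H)
    (f : hhom M (twist phi (htens V P))) : hhom M (htens V (twist phi P)) :=
  @mkhom _ _ M (htens V (twist phi P)) f (ltw_cast_subproof f).

Definition right_ptrace (phi : right_twist) (P V : hmod H)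
    (f : hhom (htens P V) (twist phi (htens P V))) : hhom P (twist phi P) :=
  hrunit (twist phi P) \oh htmap (hid (twist phi P)) (hevt g V)
    \oh hassoc (twist phi P) V (hdual V)
    \oh htmap (rtw_cast f) (hid (hdual V))
    \oh hassocV P V (hdual V)
    \oh htmap (hid P) (hcoev V) \oh hrunitV P.

Definition left_ptrace (phi : left_twist) (V P : hmod H)
    (f : hhom (htens V P) (twist phi (htens V P))) : hhom P (twist phi P) :=
  hlunit (twist phi P) \oh htmap (hev V) (hid (twist phi P))
    \oh hassocV (hdual V) V (twist phi P)
    \oh htmap (hid (hdual V)) (ltw_cast f)
    \oh hassoc (hdual V) V P
    \oh htmap (hcoevt g V) (hid P) \oh hlunitV P.

Definition trace_family (phi : {lrmorphism H -> H}) : Type :=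
  forall P : pmod H, {scalar hhom P (twist phi P)}.

Definition cyclic_trace phi (t : trace_family phi) : Prop :=
  forall (P P' : pmod H) (f : hhom P' (twist phi P)) (h : hhom P P'),
    t P (f \oh h) = t P' (twisth phi h \oh f).

Definition right_module_trace (phi : right_twist) (t : trace_family phi) : Prop :=
  cyclic_trace t /\
  forall P V (f : hhom (ptensr P V) (twist phi (ptensr P V))),
    t (ptensr P V) f = t P (right_ptrace f).

Definition left_module_trace (phi : left_twist) (t : trace_family phi) : Prop :=
  cyclic_trace t /\
  forall V P (f : hhom (ptensl g V P) (twist phi (ptensl g V P))),
    t (ptensl g V P) f = t P (left_ptrace f).

(* Module traces for the identity functor id_*.                               *)
Definition right_modified_trace : trace_family rtw_id -> Prop :=
  @right_module_trace rtw_id.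
Definition left_modified_trace : trace_family ltw_id -> Prop :=
  @left_module_trace ltw_id.

Definition nonzero_trace phi (t : trace_family phi) : Prop :=
  exists P (f : hhom P (twist phi P)), t P f != 0.

Definition nondegenerate_trace phi (t : trace_family phi) : Prop :=
  forall P P' : pmod H,
    (forall f : hhom P' (twist phi P),
       (forall h : hhom P P', t P (f \oh h) = 0) -> f = 0) /\
    (forall h : hhom P P',
       (forall f : hhom P' (twist phi P), t P (f \oh h) = 0) -> h = 0).

(* Families are compared pointwise, to avoid functional extensionality.       *)
Definition trace_space_dim1 phi (T : trace_family phi -> Prop) : Prop :=
  exists2 t0 : trace_family phi, nonzero_trace t0 &
    forall t, T t <-> exists c : K, forall P f, t P f = c * t0 P f.

Definition trace_space_trivial phi (T : trace_family phi -> Prop) : Prop :=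
  forall t, T t <-> forall P f, t P f = 0.

Definition left_cointegral (c : H) : Prop := forall a, a * c = counit a *: c.

Definition is_modulus (alpha : {lrmorphism H -> K | *%R}) : Prop :=
  exists c : H, [/\ c != 0, left_cointegral c & forall a, c * a = alpha a *: c].

(* alpha is to be the modulus of H. *)
Definition unimodular (alpha : {lrmorphism H -> K | *%R}) : Prop := alpha =1 counit.

Definition right_integral (mu : {scalar H}) : Prop :=
  forall a, \sw_(x, y <- a) (mu x *: y) = mu a *: 1.

Definition left_integral (mu : {scalar H}) : Prop :=
  forall a, \sw_(x, y <- a) (mu y *: x) = mu a *: 1.

End Traces.

(* Main.v *)
Require Import Defs.
From HB Require Import structures.
From mathcomp Require Import all_boot all_order all_algebra all_field.
Set Implicit Arguments.
Unset Strict Implicit.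
Unset Printing Implicit Defensive.
Import GRing.Theory.
Local Open Scope ring_scope.

(** A projective H-module is a direct summand of a free one, so a family t that
  is cyclic for the twist by phi is determined by the linear form
  tau x = t_H (a |-> phi a * x) on H. With a dual basis p_i, pi_i of P one has
  t_P f = sum_i tau (pi_i (f p_i)), and a linear form tau comes from a cyclic
  family exactly when tau (phi y * x) = tau (x * y) (trace_form_cyclic,
  ctrace_cyclic, cyclic_trace_dual_basis).

  The compatibility with tensor products can be read off on H (x) V. This module
  is free on 1 (x) V, with coordinate maps a (x) v |-> xi (S a_2 v) a_1, and
  comparing the two sides of the axiom turns it into
  tau x_1 S x_2 = tau x g for all x, that is, into the statement that
  mu = tau (g^-1 * _) is a right integral (right_compatibleP). The twist phi
  disappears here: it only survives in the cyclicity, which, because S^2 is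
  conjugation by g, reads mu (S^2 (phi y) * x) = mu (x * y).

  What remains is the theory of integrals, developed from the cointegral c that
  defines the modulus alpha. The identities c_1 (x) a c_2 = S a c_1 (x) c_2 and
  c_1 a (x) c_2 = c_1 (x) c_2 S (R(alpha) a) show that the contraction
  xi |-> xi c_1 c_2 is bijective from the dual of H to H; the preimage of 1 is
  a right integral, unique up to a scalar. The forms mu (S^2 (R(alpha) a) * _) and
  mu (_ * a) have the same contraction, hence mu (S^2 (R(alpha) a) * x) = mu (x * a)
  (right_integral_nakayama), and mu (a * _) = 0 only for a = 0. Thus a non-zero
  module trace exists if and only if phi = R(alpha), and then it is unique up to a
  scalar and non-degenerate. For phi = R(nu), composing with the counit gives
  nu = alpha; for phi = id it gives alpha = counit.

  The left-handed case is the mirror image: V (x) H is free on V (x) 1 with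
  coordinate maps v (x) a |-> xi (S^-1 a_1 v) a_2, and the contraction is
  xi |-> c_1 xi c_2. *)

(** * Linearity, linear forms and Sweedler sums *)

Lemma lin_scalar_rm (K : fieldType) (U : vectType K) (H : hopfAlgType K)
    (nu : {lrmorphism H -> K | *%R}) (f : U -> H) : linear f -> scalar (fun x => nu (f x)).
Proof. by move=> lf k x y /=; rewrite lf linearP. Qed.

Lemma lin_form (K : fieldType) (U V : vectType K) (xi : dual V) (f : U -> V) :
  linear f -> scalar (fun x => xi (f x) : K).
Proof. by move=> lf k x y /=; rewrite lf linearP. Qed.

Lemma lin_form_app (K : fieldType) (U V : vectType K) (f : U -> dual V) v :
  linear f -> scalar (fun x => (f x : dual V) v : K).
Proof. by move=> lf k x y /=; rewrite lf add_lfunE scale_lfunE. Qed.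

Lemma lin_sum_fin (K : fieldType) (U V : vectType K) (I : finType) (f : I -> U -> V) :
  (forall i, linear (f i)) -> linear (fun x => \sum_i f i x).
Proof.
move=> lf k x y /=; rewrite scaler_sumr -big_split; apply: eq_bigr => i _ /=.
exact: lf.
Qed.

(** Proves that a Sweedler expression is linear in a variable, by descending to
  that variable one operation at a time. *)
Ltac hlin1 := first
  [ eassumption | apply lin_id | apply lin_purel | apply lin_purer
  | apply lin_mull | apply lin_mulr | apply lin_scalel | apply lin_scaler
  | apply lin_sw | apply lin_swa | apply lin_hom | apply lin_tlift
  | apply lin_sum_fin | apply lin_hom_app | apply lin_compl | apply lin_compr
  | apply lin_hact | apply lin_tmapl | apply lin_tmapr
  | apply lin_lin | apply lin_scalar_rm | apply lin_form | apply lin_form_app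
  | apply lin_scalar ].
Ltac hlin := simpl; intros; repeat (hlin1; simpl; intros).

(** The same for expressions built from an abstract bilinear map, whose linearity
  in each variable is given by l1 and l2. *)
Ltac blin l1 l2 := repeat first
  [ progress hlin | apply: (lin_comp (l1 _)) | apply: (lin_comp (l2 _)) ].

Lemma lin_fin_sum (K : fieldType) (V W : lmodType K) (f : V -> W) : linear f ->
  forall (I : finType) (F : I -> V), f (\sum_i F i) = \sum_i f (F i).
Proof.
move=> lf I F; pose G : {linear V -> W} := HB.pack f (GRing.isLinear.Build K V W *:%R f lf).
exact: (linear_sum G).
Qed.

Lemma tens_lin_eq (K : fieldType) (V W U : vectType K) (f h : tens V W -> U) :
  linear f -> linear h -> (forall v w, f (pure v w) = h (pure v w)) -> forall T, f T = h T.
Proof.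
move=> lf lh fh T; rewrite -(linfunE lf) -(linfunE lh); congr (fun_of_lfun _ T).
by apply: tens_eq => v w; rewrite !linfunE.
Qed.

Section Forms.
Variables (K : fieldType) (H : hopfAlgType K).
Implicit Types (a b : H).

Definition mkform (f : H -> K) (f_lin : scalar f) : {scalar H} :=
  HB.pack f (GRing.isLinear.Build K H K *%R f f_lin).

Lemma form_eq (a b : H) : (forall e : {scalar H}, e a = e b) -> a = b.
Proof.
by move=> ab; rewrite [a]bvecE [b]bvecE; apply: eq_bigr => i _; rewrite (ab (coord _ i)).
Qed.

Lemma dual_form (xi : dual H) : scalar (fun a : H => xi a : K).
Proof. by hlin. Qed.

Lemma sw_sub (U : vectType K) a (E F : H -> H -> U) :
  \sw_(x, y <- a) (E x y - F x y) = sw a E - sw a F.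
Proof.
rewrite /sw !tliftT -sumrB; apply: eq_bigr => i _; rewrite -sumrB.
by apply: eq_bigr => j _; rewrite scalerBr.
Qed.

Lemma sw_sum (U : vectType K) (I : finType) a
    (F : I -> H -> H -> U) :
  \sw_(x, y <- a) (\sum_i F i x y) = \sum_i sw a (F i).
Proof.
rewrite /sw tliftT.
under eq_bigr do under eq_bigr do rewrite scaler_sumr.
under eq_bigr do rewrite exchange_big /=.
by rewrite exchange_big; apply: eq_bigr => i _; rewrite tliftT.
Qed.

End Forms.

(** * The inverse of the antipode of a pivotal Hopf algebra *)

Section Antipode.
Variables (K : fieldType) (H : hopfAlgType K) (g : pivotal H).
Implicit Types (a b x y : H) (U : vectType K).
Notation S := (antipode : 'End(H)).

Lemma sw_pivotl U (t : H -> H -> U) a :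
    (forall y, linear (fun x => t x y)) -> (forall x, linear (t x)) ->
  \sw_(x, y <- (g : H) * a) t x y = \sw_(x, y <- a) t ((g : H) * x) ((g : H) * y).
Proof.
move=> l1 l2; rewrite swM //; have [gD _] := pivot_group_like g.
by rewrite {1}/sw gD tliftE //; blin l1 l2.
Qed.

Lemma antipode_pivot : S (g : H) = (g : H)^-1.
Proof.
have [gD ge] := pivot_group_like g.
apply: (mulIr (pivot_unit g)); rewrite mulVr ?pivot_unit //.
by have := antipodel (g : H); rewrite gD ge scale1r tliftE //; hlin.
Qed.

Lemma antipode_pivotV : S (g : H)^-1 = (g : H).
Proof.
have gVu : (g : H)^-1 \is a GRing.unit by rewrite unitrV pivot_unit.
apply: (mulIr gVu); rewrite divrr ?pivot_unit //.
by rewrite -{2}antipode_pivot -antipodeM divrr ?pivot_unit // antipode1.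
Qed.

(** Since S^2 is conjugation by g, the inverse of S can be written with S itself. *)
Definition antipodeV a : H := S ((g : H)^-1 * a * (g : H)).

Lemma antipodeVK a : S (antipodeV a) = a.
Proof.
rewrite /antipodeV (pivot_antipode2 g) !mulrA divrr ?pivot_unit // mul1r.
by rewrite mulrK ?pivot_unit.
Qed.

Lemma antipode_inj : injective S.
Proof.
move=> a b /(congr1 S); rewrite !(pivot_antipode2 g).
have gVu : (g : H)^-1 \is a GRing.unit by rewrite unitrV pivot_unit.
by move/(mulIr gVu)/(mulrI (pivot_unit g)).
Qed.

Lemma antipodeK a : antipodeV (S a) = a.
Proof. by apply: antipode_inj; rewrite antipodeVK. Qed.

Lemma antipodeV1 : antipodeV 1 = 1.
Proof. by rewrite -{1}antipode1 antipodeK. Qed.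

Lemma antipodeVM a b : antipodeV (a * b) = antipodeV b * antipodeV a.
Proof. by apply: antipode_inj; rewrite antipodeM !antipodeVK. Qed.

Lemma antipodeV_pivot : antipodeV (g : H) = (g : H)^-1.
Proof. by apply: antipode_inj; rewrite antipodeVK antipode_pivotV. Qed.

Lemma antipodeV2 a :
  antipodeV (antipodeV a) = (g : H)^-1 * a * (g : H).
Proof. by apply: antipode_inj; rewrite antipodeVK. Qed.

Lemma antipodeV_linear : linear antipodeV.
Proof. by rewrite /antipodeV; hlin. Qed.

Lemma sw_antipodeVl U (f : H -> U) a : linear f ->
  \sw_(x, y <- a) f (antipodeV y * x) = counit a *: f 1.
Proof.
move=> lf; pose F z := f (antipodeV z).
have lF : linear F by apply: lin_comp lf antipodeV_linear.
have := sw_antipodel (f := F) a lF; rewrite /F antipodeV1 => <-.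
by apply: eq_sw => x y; rewrite antipodeVM antipodeK.
Qed.

Lemma sw_antipodeVr U (f : H -> U) a : linear f ->
  \sw_(x, y <- a) f (y * antipodeV x) = counit a *: f 1.
Proof.
move=> lf; pose F z := f (antipodeV z).
have lF : linear F by apply: lin_comp lf antipodeV_linear.
have := sw_antipoder (f := F) a lF; rewrite /F antipodeV1 => <-.
by apply: eq_sw => x y; rewrite antipodeVM antipodeK.
Qed.

End Antipode.

(** * Moving factors across the coproduct of a cointegral *)

Section Cointegral.
Variables (K : fieldType) (H : hopfAlgType K) (g : pivotal H).
Variables (alpha : {lrmorphism H -> K | *%R}) (c : H).
Hypothesis c_left : left_cointegral c.
Hypothesis c_right : forall a, c * a = alpha a *: c.
Implicit Types (a b x y : H) (U : vectType K) (mu : {scalar H}).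
Notation S := (antipode : 'End(H)).
Notation SV := (antipodeV g).

Section Slide.
Variables (U : vectType K) (B : H -> H -> U).
Hypotheses (Bl : forall y, linear (fun x => B x y)) (Br : forall x, linear (B x)).

(** Insert S a_1 a_2 in front of c_1 and use a_2 c_1 (x) a_3 c_2 =
  Delta (a_2 c) = counit a_2 Delta c. *)
Lemma cointegral_slide_left a :
  \sw_(x, y <- c) B (S a * x) y = \sw_(x, y <- c) B x (a * y).
Proof.
transitivity (\sw_(p, q <- a) \sw_(x, y <- q * c) B (S p * x) y).
  rewrite -(sw_counitr (f := fun p => \sw_(x, y <- c) B (S p * x) y)); last by blin Bl Br.
  apply: eq_sw => p q; rewrite c_left.
  by rewrite (linD (f := fun d => sw d _)) //; hlin.
transitivity (\sw_(p, q <- a) \sw_(q1, q2 <- q) \sw_(x, y <- c) B (S p * q1 * x) (q2 * y)).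
  apply: eq_sw => p q; rewrite swM; [|by blin Bl Br..].
  by apply: eq_sw => q1 q2; apply: eq_sw => x y; rewrite mulrA.
rewrite -(swA (t := fun p q1 q2 => \sw_(x, y <- c) B (S p * q1 * x) (q2 * y))); [|by blin Bl Br..].
rewrite -(sw_counitl (f := fun q2 => \sw_(x, y <- c) B x (q2 * y))); last by blin Bl Br.
apply: eq_sw => u q2.
rewrite (sw_antipodel (f := fun z => \sw_(x, y <- c) B (z * x) (q2 * y))); last by blin Bl Br.
by congr (_ *: _); apply: eq_sw => x y; rewrite mul1r.
Qed.

(** Insert a_2 S a_3 behind c_2 and use Delta (c a_1) = alpha a_1 Delta c, which
  leaves alpha a_1 S a_2 = S (R(alpha) a). *)
Lemma cointegral_slide_right a :
  \sw_(x, y <- c) B (x * a) y = \sw_(x, y <- c) B x (y * S (Rmap alpha a)).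
Proof.
transitivity (\sw_(p, q <- a) \sw_(x, y <- c * p) B x (y * S q)); last first.
  rewrite /Rmap (@sw_push _ _ _ _ a (fun r => \sw_(x, y <- c) B x (y * S r)));
    last by blin Bl Br.
  apply: eq_sw => p q; rewrite c_right (linD (f := fun d => sw d _)); last by hlin.
  by rewrite (linD (f := fun r => \sw_(x, y <- c) B x (y * S r))) //; blin Bl Br.
transitivity (\sw_(p, q <- a) \sw_(p1, p2 <- p) \sw_(x, y <- c) B (x * p1) (y * (p2 * S q)));
  last first.
  apply: eq_sw => p q; rewrite swM; [|by blin Bl Br..]; rewrite sw_exchange.
  by apply: eq_sw => p1 p2; apply: eq_sw => x y; rewrite mulrA.
rewrite (swA (t := fun p1 p2 q => \sw_(x, y <- c) B (x * p1) (y * (p2 * S q))));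
  [|by blin Bl Br..].
rewrite -(sw_counitr (f := fun p => \sw_(x, y <- c) B (x * p) y)); last by blin Bl Br.
apply: eq_sw => p u.
rewrite (sw_antipoder (f := fun z => \sw_(x, y <- c) B (x * p) (y * z))); last by blin Bl Br.
by congr (_ *: _); apply: eq_sw => x y; rewrite mulr1.
Qed.

(** Insert a_2 S^-1 a_1 behind c_1 and use Delta (c a_2) = alpha a_2 Delta c. *)
Lemma cointegral_slide_rightV a :
  \sw_(x, y <- c) B x (y * a) = \sw_(x, y <- c) B (x * SV (Lmap alpha a)) y.
Proof.
transitivity (\sw_(p, q <- a) \sw_(x, y <- c * q) B (x * SV p) y); last first.
  rewrite /Lmap (@sw_push _ _ _ _ a (fun r => \sw_(x, y <- c) B (x * SV r) y));
    last by blin Bl Br.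
  apply: eq_sw => p q; rewrite c_right (linD (f := fun d => sw d _)); last by hlin.
  by rewrite (linD (f := fun r => \sw_(x, y <- c) B (x * SV r) y)) //; blin Bl Br.
transitivity (\sw_(p, q <- a) \sw_(q1, q2 <- q) \sw_(x, y <- c) B (x * (q1 * SV p)) (y * q2));
  last first.
  apply: eq_sw => p q; rewrite swM; [|by blin Bl Br..]; rewrite sw_exchange.
  by apply: eq_sw => q1 q2; apply: eq_sw => x y; rewrite mulrA.
rewrite -(swA (t := fun p q1 q2 => \sw_(x, y <- c) B (x * (q1 * SV p)) (y * q2)));
  [|by blin Bl Br..].
rewrite -(sw_counitl (f := fun q => \sw_(x, y <- c) B x (y * q))); last by blin Bl Br.
apply: eq_sw => u q.
rewrite (sw_antipodeVr g (f := fun z => \sw_(x, y <- c) B (x * z) (y * q)));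
  last by blin Bl Br.
by congr (_ *: _); apply: eq_sw => x y; rewrite mulr1.
Qed.

End Slide.

Hypothesis c_neq0 : c != 0.

(** If mu contracts c_1 to 0, so does mu (b * _) for every b, by sliding. Then b may
  even be a function of the other tensor factors of the iterated coproduct of c:
  choosing b S^-1 c_2 gives 0 = mu (b S^-1 c_2 c_1) c_3 = mu b c. *)
Lemma cointegral_contract_left_inj mu :
  \sw_(x, y <- c) (mu x *: y) = 0 -> forall b, mu b = 0.
Proof.
move=> mu0.
have mu0b b : \sw_(x, y <- c) (mu (b * x) *: y) = 0.
  transitivity (SV b * \sw_(x, y <- c) (mu x *: y)); last by rewrite mu0 mulr0.
  rewrite -[b in LHS](antipodeVK g).
  rewrite (cointegral_slide_left (B := fun x y => mu x *: y)); [|by hlin..].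
  rewrite (@sw_push _ _ _ _ c (fun y => SV b * y)); last by hlin.
  by apply: eq_sw => x y; rewrite scalerAr.
move=> b; have /eqP : mu b *: c = 0; last by rewrite scaler_eq0 (negPf c_neq0) orbF => /eqP.
transitivity (\sw_(u, z <- c) (counit u *: (mu b *: z))).
  by rewrite (sw_counitl (f := fun z => mu b *: z)) //; hlin.
transitivity (\sw_(u, z <- c) \sw_(x, y <- u) (mu (b * (SV y * x)) *: z)).
  apply: eq_sw => u z.
  rewrite (sw_antipodeVl g (f := fun r => mu (b * r) *: z)); last by hlin.
  by rewrite mulr1.
rewrite (swA (t := fun x y z => mu (b * (SV y * x)) *: z)); [|by hlin..].
(* Expanding the middle factor in a basis makes it a constant multiplier. *)
pose F i v := \sw_(y, z <- v) (coord (vbasis {:H}) i y *: z).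
transitivity (\sum_i F i (\sw_(x, v <- c) (mu (b * SV (bvec i) * x) *: v))); last first.
  rewrite big1 // => i _; rewrite mu0b (linD (f := F i)) // /F; hlin.
transitivity (\sw_(x, v <- c) \sum_i (mu (b * SV (bvec i) * x) *: F i v)); last first.
  rewrite /sw tlift_sum; apply: eq_bigr => i _.
  rewrite (@sw_push _ _ _ _ c (F i)); last by rewrite /F; hlin.
  by apply: eq_sw => x v; rewrite (linD (f := F i)) // /F; hlin.
apply: eq_sw => x v.
under eq_bigr do rewrite /F -sw_scale; rewrite -tlift_sum; apply: eq_sw => y z.
rewrite {1}[y]bvecE.
rewrite (linS (f := fun y => mu (b * (SV y * x)) *: z)); last by hlin.
apply: eq_bigr => i _; rewrite (linD (f := fun y => mu (b * (SV y * x)) *: z)); last by hlin.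
by rewrite mulrA !scalerA mulrC.
Qed.

(** The mirror image, with 0 = c_1 mu (b S c_2 c_3) = mu b c. *)
Lemma cointegral_contract_right_inj mu :
  \sw_(x, y <- c) (mu y *: x) = 0 -> forall b, mu b = 0.
Proof.
move=> mu0.
have mu0b b : \sw_(x, y <- c) (mu (b * y) *: x) = 0.
  transitivity (S b * \sw_(x, y <- c) (mu y *: x)); last by rewrite mu0 mulr0.
  rewrite -(cointegral_slide_left (B := fun x y => mu y *: x)); [|by hlin..].
  rewrite (@sw_push _ _ _ _ c (fun y => S b * y)); last by hlin.
  by apply: eq_sw => x y; rewrite scalerAr.
move=> b; have /eqP : mu b *: c = 0; last by rewrite scaler_eq0 (negPf c_neq0) orbF => /eqP.
transitivity (\sw_(x, u <- c) (counit u *: (mu b *: x))).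
  by rewrite (sw_counitr (f := fun z => mu b *: z)) //; hlin.
transitivity (\sw_(x, u <- c) \sw_(y, z <- u) (mu (b * (S y * z)) *: x)).
  apply: eq_sw => x u.
  rewrite (sw_antipodel (f := fun r => mu (b * r) *: x)); last by hlin.
  by rewrite mulr1.
rewrite -(swA (t := fun x y z => mu (b * (S y * z)) *: x)); [|by hlin..].
(* Expanding the middle factor in a basis makes it a constant multiplier. *)
pose F i v := \sw_(x, y <- v) (coord (vbasis {:H}) i y *: x).
transitivity (\sum_i F i (\sw_(v, z <- c) (mu (b * S (bvec i) * z) *: v))); last first.
  rewrite big1 // => i _; rewrite mu0b (linD (f := F i)) // /F; hlin.
transitivity (\sw_(v, z <- c) \sum_i (mu (b * S (bvec i) * z) *: F i v)); last first.
  rewrite /sw tlift_sum; apply: eq_bigr => i _.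
  rewrite (@sw_push _ _ _ _ c (F i)); last by rewrite /F; hlin.
  by apply: eq_sw => v z; rewrite (linD (f := F i)) // /F; hlin.
apply: eq_sw => v z.
under eq_bigr do rewrite /F -sw_scale; rewrite -tlift_sum; apply: eq_sw => x y.
rewrite {1}[y]bvecE.
rewrite (linS (f := fun y => mu (b * (S y * z)) *: x)); last by hlin.
apply: eq_bigr => i _; rewrite (linD (f := fun y => mu (b * (S y * z)) *: x)); last by hlin.
by rewrite mulrA !scalerA mulrC.
Qed.

End Cointegral.

(** * Integrals of a finite-dimensional pivotal Hopf algebra *)

Section Integrals.
Variables (K : fieldType) (H : hopfAlgType K).
Implicit Types (a b x y : H) (mu : {scalar H}).
Notation S := (antipode : 'End(H)).

(** H and its dual have the same dimension. *)
Lemma dual_onto (T : dual H -> H) : linear T -> (forall xi, T xi = 0 -> xi = 0) ->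
  forall y, exists xi, T xi = y.
Proof.
move=> T_lin T_inj y; have TE := linfunE T_lin.
have ker0 : lker (linfun T) = 0%VS.
  apply/vspaceP=> xi; rewrite memv_ker memv0 TE.
  by apply/eqP/eqP => [/T_inj // | ->]; rewrite (linD T_lin).
have: y \in limg (linfun T).
  suff -> : limg (linfun T) = fullv by exact: memvf.
  apply/eqP; rewrite eqEdim subvf limg_dim_eq ?ker0 ?capv0 //.
  by rewrite !dimvf /dim /= muln1.
by case/memv_imgP=> xi _ ->; exists xi; rewrite TE.
Qed.


Variables (g : pivotal H) (alpha : {lrmorphism H -> K | *%R}) (c : H).
Hypothesis c_left : left_cointegral c.
Hypothesis c_right : forall a, c * a = alpha a *: c.
Hypothesis c_neq0 : c != 0.

Lemma cointegral_contract_left_eq (f f' : H -> K) : scalar f -> scalar f' ->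
  \sw_(x, y <- c) (f x *: y) = \sw_(x, y <- c) (f' x *: y) -> f =1 f'.
Proof.
move=> lf lf' ff'; have lD : scalar (fun a => f a - f' a).
  by move=> k x y; rewrite lf lf' mulrBr opprD addrACA.
move=> a; apply/eqP; rewrite -subr_eq0; apply/eqP.
apply: (cointegral_contract_left_inj g c_left c_neq0 (mu := mkform lD)).
transitivity (\sw_(x, y <- c) (f x *: y - f' x *: y)); last by rewrite sw_sub ff' subrr.
by apply: eq_sw => x y; rewrite -scalerBl.
Qed.

Lemma cointegral_contract_right_eq (f f' : H -> K) : scalar f -> scalar f' ->
  \sw_(x, y <- c) (f y *: x) = \sw_(x, y <- c) (f' y *: x) -> f =1 f'.
Proof.
move=> lf lf' ff'; have lD : scalar (fun a => f a - f' a).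
  by move=> k x y; rewrite lf lf' mulrBr opprD addrACA.
move=> a; apply/eqP; rewrite -subr_eq0; apply/eqP.
apply: (cointegral_contract_right_inj c_left c_neq0 (mu := mkform lD)).
transitivity (\sw_(x, y <- c) (f y *: x - f' y *: x)); last by rewrite sw_sub ff' subrr.
by apply: eq_sw => x y; rewrite -scalerBl.
Qed.


(** The form mu that contracts Delta c to 1 is an integral: for any form e, the forms
  b |-> e (mu b_1 b_2) and b |-> mu b e 1 have the same contraction against c,
  by coassociativity. *)
Lemma right_integral_ex : exists2 mu : {scalar H}, right_integral mu & mu c = 1.
Proof.
have [||xi xi1] := @dual_onto (fun xi => \sw_(x, y <- c) ((xi x : K) *: y)) _ _ 1.
- by hlin.
- move=> xi xi0; apply/lfunP=> a; rewrite zero_lfunE.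
  exact: (cointegral_contract_left_inj g c_left c_neq0 (mu := mkform (dual_form xi))).
have [mu mu1] : exists mu : {scalar H}, \sw_(x, y <- c) (mu x *: y) = 1.
  by exists (mkform (dual_form xi)).
have mu_int : right_integral mu.
  move=> a; apply: form_eq => e.
  apply: (@cointegral_contract_left_eq (fun b => e (\sw_(x, y <- b) (mu x *: y)))
    (fun b => e (mu b *: 1))).
  - by hlin.
  - by hlin.
  pose F u := \sw_(x, y <- u) (e x *: y); have lF : linear F by rewrite /F; hlin.
  transitivity (e 1 *: \sw_(x, y <- c) (mu x *: y)); last first.
    by rewrite -sw_scale; apply: eq_sw => x y; rewrite [e (_ *: _)]linearZ /= scalerA mulrC.
  transitivity (F (\sw_(x, y <- c) (mu x *: y))); last by rewrite mu1 /F sw1 //; hlin.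
  rewrite sw_push //.
  transitivity (\sw_(p, z <- c) \sw_(x, y <- p) (mu x *: (e y *: z))).
    apply: eq_sw => p z; rewrite (@sw_push _ _ _ _ p (fun u => e u *: z)); last by hlin.
    by apply: eq_sw => x y; rewrite [e (_ *: _)]linearZ /= scalerA.
  rewrite (swA (t := fun x y z => mu x *: (e y *: z))); [|by hlin..].
  by apply: eq_sw => x u; rewrite sw_scale (linD lF).
exists mu => //; apply: (@fmorph_inj _ _ (in_alg H)).
by rewrite rmorph1 -mu1 [RHS]mu_int.
Qed.

Lemma left_integral_ex : exists2 mu : {scalar H}, left_integral mu & mu c = 1.
Proof.
have [||xi xi1] := @dual_onto (fun xi => \sw_(x, y <- c) ((xi y : K) *: x)) _ _ 1.
- by hlin.
- move=> xi xi0; apply/lfunP=> a; rewrite zero_lfunE.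
  exact: (cointegral_contract_right_inj c_left c_neq0 (mu := mkform (dual_form xi))).
have [mu mu1] : exists mu : {scalar H}, \sw_(x, y <- c) (mu y *: x) = 1.
  by exists (mkform (dual_form xi)).
have mu_int : left_integral mu.
  move=> a; apply: form_eq => e.
  apply: (@cointegral_contract_right_eq (fun b => e (\sw_(x, y <- b) (mu y *: x)))
    (fun b => e (mu b *: 1))).
  - by hlin.
  - by hlin.
  pose F u := \sw_(x, y <- u) (e y *: x); have lF : linear F by rewrite /F; hlin.
  transitivity (e 1 *: \sw_(x, y <- c) (mu y *: x)); last first.
    by rewrite -sw_scale; apply: eq_sw => x y; rewrite [e (_ *: _)]linearZ /= scalerA mulrC.
  transitivity (F (\sw_(x, y <- c) (mu y *: x))); last by rewrite mu1 /F sw1 //; hlin.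
  rewrite sw_push //.
  transitivity (\sw_(x, u <- c) \sw_(y, z <- u) (mu z *: (e y *: x))).
    apply: eq_sw => x u; rewrite (@sw_push _ _ _ _ u (fun v => e v *: x)); last by hlin.
    by apply: eq_sw => y z; rewrite [e (_ *: _)]linearZ /= scalerA.
  rewrite -(swA (t := fun x y z => mu z *: (e y *: x))); [|by hlin..].
  by apply: eq_sw => u z; rewrite sw_scale (linD lF).
exists mu => //; apply: (@fmorph_inj _ _ (in_alg H)).
by rewrite rmorph1 -mu1 [RHS]mu_int.
Qed.

Lemma right_integral_eq0 mu : right_integral mu -> mu c = 0 -> forall a, mu a = 0.
Proof.
move=> mu_int muc0; apply: (cointegral_contract_left_inj g c_left c_neq0).
by rewrite [LHS]mu_int muc0 scale0r.
Qed.

Lemma left_integral_eq0 mu : left_integral mu -> mu c = 0 -> forall a, mu a = 0.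
Proof.
move=> mu_int muc0; apply: (cointegral_contract_right_inj c_left c_neq0).
by rewrite [LHS]mu_int muc0 scale0r.
Qed.

(** Two integrals contract Delta c to multiples of 1, and the contraction is
  injective. *)
Lemma right_integral_unique mu mu' : right_integral mu -> right_integral mu' ->
  forall a, mu' c * mu a = mu c * mu' a.
Proof.
move=> mu_int mu'_int.
apply: (@cointegral_contract_left_eq (fun a => mu' c * mu a) (fun a => mu c * mu' a)).
- by apply: (lin_scaler (V := K^o)); hlin.
- by apply: (lin_scaler (V := K^o)); hlin.
transitivity (mu' c *: (mu c *: (1 : H))).
  by rewrite -(mu_int c) -sw_scale; apply: eq_sw => x y; rewrite scalerA.
rewrite scalerA mulrC -scalerA -(mu'_int c) -sw_scale.
by apply: eq_sw => x y; rewrite scalerA.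
Qed.

Lemma left_integral_unique mu mu' : left_integral mu -> left_integral mu' ->
  forall a, mu' c * mu a = mu c * mu' a.
Proof.
move=> mu_int mu'_int.
apply: (@cointegral_contract_right_eq (fun a => mu' c * mu a) (fun a => mu c * mu' a)).
- by apply: (lin_scaler (V := K^o)); hlin.
- by apply: (lin_scaler (V := K^o)); hlin.
transitivity (mu' c *: (mu c *: (1 : H))).
  by rewrite -(mu_int c) -sw_scale; apply: eq_sw => x y; rewrite scalerA.
rewrite scalerA mulrC -scalerA -(mu'_int c) -sw_scale.
by apply: eq_sw => x y; rewrite scalerA.
Qed.

(** So a can be recovered from mu (S a * _), which is why mu is non-degenerate. *)
Lemma right_integral_slide mu a : right_integral mu ->
  \sw_(x, y <- c) (mu (S a * x) *: y) = mu c *: a.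
Proof.
move=> mu_int.
rewrite (cointegral_slide_left c_left (B := fun x y => mu x *: y)); [|by hlin..].
transitivity (a * \sw_(x, y <- c) (mu x *: y)); last by rewrite [sw _ _]mu_int -scalerAr mulr1.
rewrite (@sw_push _ _ _ _ c (fun y => a * y)); last by hlin.
by apply: eq_sw => x y; rewrite scalerAr.
Qed.

Lemma left_integral_slide mu a : left_integral mu ->
  \sw_(x, y <- c) (mu (a * y) *: x) = mu c *: S a.
Proof.
move=> mu_int.
rewrite -(cointegral_slide_left c_left (B := fun x y => mu y *: x)); [|by hlin..].
transitivity (S a * \sw_(x, y <- c) (mu y *: x)); last by rewrite [sw _ _]mu_int -scalerAr mulr1.
rewrite (@sw_push _ _ _ _ c (fun y => S a * y)); last by hlin.
by apply: eq_sw => x y; rewrite scalerAr.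
Qed.

(** The Nakayama automorphism of the Frobenius form mu: contracted against Delta c,
  both sides give mu c S (R(alpha) a), the left one by sliding S (S (R(alpha) a)) on
  the left of c_1, the right one by sliding a on its right. *)
Lemma right_integral_nakayama mu a x : right_integral mu ->
  mu (S (S (Rmap alpha a)) * x) = mu (x * a).
Proof.
move=> mu_int.
apply: (@cointegral_contract_left_eq (fun x => mu (S (S (Rmap alpha a)) * x))
  (fun x => mu (x * a))).
- by hlin.
- by hlin.
rewrite right_integral_slide //.
rewrite (cointegral_slide_right c_right (B := fun x y => mu x *: y)); [|by hlin..].
transitivity ((\sw_(x, y <- c) (mu x *: y)) * S (Rmap alpha a)).
  by rewrite [sw _ _]mu_int -scalerAl mul1r.
rewrite (@sw_push _ _ _ _ c (fun y => y * S (Rmap alpha a))); last by hlin.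
by apply: eq_sw => p q; rewrite scalerAl.
Qed.

(** Here both sides contract Delta c to mu c S^-1 (L(alpha) a). *)
Lemma left_integral_nakayama mu a x : left_integral mu ->
  mu (antipodeV g (antipodeV g (Lmap alpha a)) * x) = mu (x * a).
Proof.
move=> mu_int.
apply: (@cointegral_contract_right_eq
  (fun x => mu (antipodeV g (antipodeV g (Lmap alpha a)) * x)) (fun x => mu (x * a))).
- by hlin.
- by hlin.
rewrite left_integral_slide //.
rewrite (cointegral_slide_rightV g c_right (B := fun x y => mu y *: x)); [|by hlin..].
transitivity ((\sw_(x, y <- c) (mu y *: x)) * antipodeV g (Lmap alpha a)).
  by rewrite [sw _ _]mu_int -scalerAl mul1r antipodeVK.
rewrite (@sw_push _ _ _ _ c (fun y => y * antipodeV g (Lmap alpha a))); last by hlin.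
by apply: eq_sw => p q; rewrite scalerAl.
Qed.


Lemma right_integral_nondeg mu a : right_integral mu -> mu c != 0 ->
  (forall x, mu (a * x) = 0) -> a = 0.
Proof.
move=> mu_int muc0 a0; have := right_integral_slide (antipodeV g a) mu_int.
rewrite antipodeVK => aE; rewrite -[a](antipodeVK g).
suff -> : antipodeV g a = 0 by rewrite linear0.
apply/eqP; rewrite -(inj_eq (scalerI muc0)) -aE scaler0; apply/eqP.
transitivity (\sw_(x, y <- c) (0 *: y)); last by rewrite sw_scale scale0r.
by apply: eq_sw => x y; rewrite a0.
Qed.

Lemma left_integral_nondeg mu a : left_integral mu -> mu c != 0 ->
  (forall x, mu (a * x) = 0) -> a = 0.
Proof.
move=> mu_int muc0 a0; apply: (antipode_inj g); rewrite linear0.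
apply/eqP; rewrite -(inj_eq (scalerI muc0)) -left_integral_slide // scaler0; apply/eqP.
transitivity (\sw_(x, y <- c) (0 *: x)); last by rewrite sw_scale scale0r.
by apply: eq_sw => x y; rewrite a0.
Qed.

End Integrals.

(** * The automorphisms R(nu) and L(nu) *)

Section GroupLikeTwists.
Variables (K : fieldType) (H : hopfAlgType K) (nu : {lrmorphism H -> K | *%R}).
Notation S := (antipode : 'End(H)).

Lemma counit_Rmap a : counit (Rmap nu a) = nu a.
Proof.
apply: (@fmorph_inj _ _ (in_alg H)) => /=.
rewrite /Rmap (@sw_push _ _ _ _ a (fun z => counit z *: (1 : H))); last by hlin.
rewrite -(sw_counitr (f := fun x => nu x *: (1 : H))); last by hlin.
by apply: eq_sw => x y; rewrite linearZ scalerA mulrC.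
Qed.

Lemma counit_Lmap a : counit (Lmap nu a) = nu a.
Proof.
apply: (@fmorph_inj _ _ (in_alg H)) => /=.
rewrite /Lmap (@sw_push _ _ _ _ a (fun z => counit z *: (1 : H))); last by hlin.
rewrite -(sw_counitl (f := fun x => nu x *: (1 : H))); last by hlin.
by apply: eq_sw => x y; rewrite linearZ scalerA mulrC.
Qed.

(** R(nu) is inverted by R(nu o S). *)
Lemma Rmap_inj a : Rmap nu a = 0 -> a = 0.
Proof.
move=> a0; pose F u := \sw_(x, y <- u) (nu (S x) *: y).
transitivity (F (Rmap nu a)); last by rewrite a0 (linD (f := F)) // /F; hlin.
rewrite /Rmap (@sw_push _ _ _ _ a F); last by rewrite /F; hlin.
transitivity (\sw_(x, u <- a) \sw_(y, z <- u) (nu (x * S y) *: z)).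
  rewrite -(swA (t := fun x y z => nu (x * S y) *: z)); [|by hlin..].
  rewrite -[LHS]counitl -/(sw _ _); apply: eq_sw => x y.
  rewrite (sw_antipoder (f := fun v => nu v *: y)); last by hlin.
  by rewrite rmorph1 scale1r.
apply: eq_sw => x u; rewrite (linD (f := F)); last by rewrite /F; hlin.
by rewrite -sw_scale; apply: eq_sw => y z; rewrite rmorphM scalerA.
Qed.

End GroupLikeTwists.

(** * Dual bases of projective modules *)

Section DualBases.
Variables (K : fieldType) (H : hopfAlgType K).
Implicit Types (M N : hmod H) (P : pmod H).

Lemma hhom_sumE M N (I : finType) (F : I -> hhom M N) v :
  (\sum_i F i : hhom M N) v = \sum_i F i v.
Proof. by rewrite /hfun linear_sum sum_lfunE. Qed.

Lemma lin_hfun M N v : linear (fun f : hhom M N => f v).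
Proof. by move=> k f f'; rewrite /hfun linearP add_lfunE scale_lfunE. Qed.

Lemma hregE (a b : H) : hact (hreg H) a b = a * b.
Proof. by rewrite /= lfunE. Qed.

Fact genmap_subproof M (u : M) a b :
  (linfun (fun x : H => hact M x u) : 'Hom(hreg H, M)) (hact (hreg H) a b)
    = hact M a ((linfun (fun x : H => hact M x u) : 'Hom(hreg H, M)) b).
Proof.
by rewrite hregE !linfunE; [rewrite -comp_lfunE -hactM | hlin..].
Qed.
Definition genmap M (u : M) : hhom (hreg H) M := mkhom (genmap_subproof u).

Lemma genmapE M (u : M) a : genmap u a = hact M a u.
Proof. by rewrite [LHS]linfunE //; hlin. Qed.

Lemma genmap1 M (f : hhom (hreg H) M) : f = genmap (f (1 : H)).
Proof. by apply: hhom_eq => a; rewrite genmapE -(hfunE f) hregE mulr1. Qed.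

Lemma lin_genmap (X : vectType K) M (f : X -> M) : linear f -> linear (fun x => genmap (f x)).
Proof.
move=> lf k x y; apply: hhom_eq => a; rewrite [RHS]lin_hfun !genmapE.
by rewrite (lf k) linearP.
Qed.

(** A presentation of M as a direct summand of a free module of finite rank. *)
Definition dual_basis M (I : finType) (p : I -> M) (pi : I -> hhom M (hreg H)) : Prop :=
  forall v, \sum_i hact M (pi i v) (p i) = v.

Lemma dual_basis_preg : dual_basis (fun _ : unit => 1 : hreg H) (fun _ => hid (hreg H)).
Proof.
by move=> v; rewrite (big_pred1 tt) => [|[]] //; rewrite hregE mulr1 [LHS]id_lfunE.
Qed.

Section Free.
Variable V : vectType K.
Definition hfree_act (a : H) : 'End(tens H V) := tmap (amull a) \1%VF.
Fact hfree_lin : linear hfree_act.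
Proof. by apply: lin_tmapl; exact: linearP. Qed.
Fact hfree_act1 : hfree_act 1 = \1%VF.
Proof. by apply: tens_eq => a v; rewrite tmapE !id_lfunE lfunE /= mul1r. Qed.
Fact hfree_actM a b : hfree_act (a * b) = (hfree_act a \o hfree_act b)%VF.
Proof. by apply: tens_eq => x v; rewrite comp_lfunE !tmapE !id_lfunE !lfunE /= mulrA. Qed.
Definition hfree : hmod H := HMod hfree_lin hfree_act1 hfree_actM.

Lemma hfreeE a b v : hact hfree a (pure b v) = pure (a * b) v.
Proof. by rewrite [LHS]tmapE id_lfunE lfunE. Qed.

Lemma hfree_hom N (f : 'Hom(tens H V, N)) :
  (forall a b v, f (pure (a * b) v) = hact N a (f (pure b v))) ->
  forall a (T : hfree), f (hact hfree a T) = hact N a (f T).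
Proof.
move=> fP a T; rewrite -!comp_lfunE; congr (fun_of_lfun _ T).
by apply: tens_eq => b v; rewrite !comp_lfunE hfreeE fP.
Qed.
End Free.

(** M is the image of the free module H (x) M; the components of a section of this
  projection are the required maps to H. The property is stated as a boolean, so
  that a dual basis can be selected without a choice axiom. *)
Lemma projective_dual_basis M : projective M ->
  exists pi : {ffun 'I_(\dim {:M}) -> hhom M (hreg H)},
    [forall k, \sum_i hact M (pi i (bvec k)) (bvec i) == bvec k].
Proof.
move=> M_proj.
have qE : forall a v, (tlift (fun (a : H) v => hact M a v) : 'Hom(tens H M, M)) (pure a v)
    = hact M a v.
  by move=> a v; rewrite tliftE //; hlin.
have qP a b v : (tlift (fun (a : H) v => hact M a v) : 'Hom(tens H M, M)) (pure (a * b) v)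
   = hact M a (tlift (fun (a : H) v => hact M a v) (pure b v)).
  by rewrite !qE hactM comp_lfunE.
pose q : hhom (hfree M) M := mkhom (hfree_hom qP).
have [|s sq] := M_proj _ _ q (hid M).
  by move=> v; exists (pure 1 v); rewrite [LHS]qE hact1 id_lfunE.
pose e i : 'Hom(tens H M, H) := tlift (fun (a : H) v => coord (vbasis {:M}) i v *: a).
have eE i a v : e i (pure a v) = coord (vbasis {:M}) i v *: a.
  by rewrite /e tliftE //; hlin.
have eP i a b v : (e i : 'Hom(tens H M, hreg H)) (pure (a * b) v)
    = hact (hreg H) a ((e i : 'Hom(tens H M, hreg H)) (pure b v)).
  by rewrite hregE !eE scalerAr.
pose ei i : hhom (hfree M) (hreg H) := mkhom (hfree_hom (eP i)).
exists [ffun i => hcomp (ei i) s]; apply/forallP=> k; apply/eqP.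
transitivity (\sum_i hact M (e i (s (bvec k))) (bvec i)).
  by apply: eq_bigr => i _; rewrite ffunE hcompE.
have sqk : bvec k = q (s (bvec k)) by rewrite -hcompE sq [RHS]id_lfunE.
rewrite [RHS]sqk; move: (s (bvec k)) => T.
move: T; apply: tens_lin_eq => [||a v]; [by hlin | exact: linearP |].
rewrite [RHS]qE {2}[v]bvecE linear_sum; apply: eq_bigr => i _.
by rewrite eE linearZ (linD (@hact_lin _ _ M)) scale_lfunE.
Qed.

Definition pdual P i : hhom P (hreg H) := xchoose (projective_dual_basis (pmodP (p := P))) i.

Lemma pdualP P : dual_basis (@bvec K P) (@pdual P).
Proof.
move=> v; have /forallP pP := xchooseP (projective_dual_basis (pmodP (p := P))).
transitivity (\sum_k coord (vbasis {:P}) k v *: bvec k); last by rewrite -bvecE.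
transitivity (\sum_k coord (vbasis {:P}) k v *:
    (\sum_i hact P (pdual i (bvec k)) (bvec i))); last first.
  by apply: eq_bigr => k _; congr (_ *: _); apply/eqP; exact: pP.
rewrite {1}[v]bvecE.
rewrite (linS (f := fun v => \sum_i hact P (pdual i v) (bvec i))); last by hlin.
apply: eq_bigr => k _.
by rewrite (linD (f := fun v => \sum_i hact P (pdual i v) (bvec i))) //; hlin.
Qed.
End DualBases.

(** * Cyclic families of traces and twisted-cyclic linear forms *)

Section CyclicTraces.
Variables (K : fieldType) (H : hopfAlgType K) (phi : {lrmorphism H -> H}).
Implicit Types (M N : hmod H) (P : pmod H) (tau : {scalar H}) (t : trace_family phi).
Local Notation treg_mod := (twist phi (hreg H)).

Lemma tregE (a b : H) : hact treg_mod a b = phi a * b.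
Proof. exact: hregE. Qed.

Lemma twisthE M N (f : hhom M N) v : twisth phi f v = f v.
Proof. by []. Qed.

(** The form tau of t, as f |-> f 1 identifies the morphisms from H to its twist with
  H. *)
Definition trace_form_def t (x : H) : K := t (preg H) (genmap (x : treg_mod)).
Fact trace_form_lin t : scalar (trace_form_def t).
Proof.
move=> k x y; rewrite /trace_form_def -linearP; congr (t _ _).
by rewrite -(@lin_genmap K H treg_mod treg_mod id).
Qed.
Definition trace_form t : {scalar H} := mkform (trace_form_lin t).

Lemma trace_formE t (f : hhom (hreg H) treg_mod) : t (preg H) f = trace_form t (f (1 : H)).
Proof. by rewrite [f in LHS]genmap1. Qed.

Definition twisted_cyclic tau := forall x y, tau (phi y * x) = tau (x * y).

Lemma trace_form_cyclic t : cyclic_trace t -> twisted_cyclic (trace_form t).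
Proof.
move=> t_cyc x y.
have := t_cyc (preg H) (preg H) (genmap (x : treg_mod)) (genmap (y : hreg H)).
by rewrite !trace_formE !hcompE twisthE !genmapE !tregE !hregE !rmorph1 !mul1r.
Qed.

(** Both sides equal the double sum of tau (pi_i (f p'_j) * pi'_j (h p_i)), as one sees
  by expanding h p_i, respectively f p'_j, in the other dual basis. With P = P' and
  h = id, this makes the trace of f independent of the dual basis. *)
Lemma dual_basis_swap (P P' : hmod H) (I J : finType) (p : I -> P) (p' : J -> P')
    (pi : I -> hhom P (hreg H)) (pi' : J -> hhom P' (hreg H)) tau
    (f : hhom P' (twist phi P)) (h : hhom P P') :
  twisted_cyclic tau -> dual_basis p pi -> dual_basis p' pi' ->
  \sum_i tau (pi i (f (h (p i)))) = \sum_j tau (pi' j (h (f (p' j)))).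
Proof.
move=> tau_cyc pP p'P.
transitivity (\sum_i \sum_j tau ((pi i (f (p' j)) : H) * pi' j (h (p i)))).
  apply: eq_bigr => i _; rewrite -[h (p i) in LHS]p'P !linear_sum; apply: eq_bigr => j _ /=.
  by rewrite (hfunE f) (hfunE (pi i)) hregE tau_cyc.
rewrite exchange_big; apply: eq_bigr => j _.
rewrite -[f (p' j) in RHS]pP !linear_sum; apply: eq_bigr => i _ /=.
by rewrite (hfunE h) (hfunE (pi' j)) hregE.
Qed.

(** f is the sum of the maps f o p_i o pi_i, which factor through H. *)
Lemma cyclic_trace_dual_basis t P (I : finType) (p : I -> P) (pi : I -> hhom P (hreg H))
    (f : hhom P (twist phi P)) :
  cyclic_trace t -> dual_basis p pi -> t P f = \sum_i trace_form t (pi i (f (p i))).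
Proof.
move=> t_cyc pP.
transitivity (t P (\sum_i (f \oh genmap (p i) \oh pi i))).
  congr (t P _); apply: hhom_eq => v; rewrite -{1}[v]pP linear_sum hhom_sumE.
  by apply: eq_bigr => i _; rewrite !hcompE genmapE.
rewrite linear_sum; apply: eq_bigr => i _; rewrite (t_cyc P (preg H)) trace_formE.
by rewrite !hcompE genmapE hact1 id_lfunE.
Qed.

Lemma nonzero_trace_form t : cyclic_trace t -> nonzero_trace t -> exists x, trace_form t x != 0.
Proof.
move=> t_cyc [P [f tf0]]; have tE := cyclic_trace_dual_basis f t_cyc (pdualP (P := P)).
case: (pickP (fun i => trace_form t (pdual (P := P) i (f (bvec i))) != 0)) => [i ti0 | t0].
  by exists (pdual (P := P) i (f (bvec i))).
by case/eqP: tf0; rewrite tE big1 // => i _; apply/eqP/negbFE/t0.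
Qed.

Lemma cyclic_trace_ext t t' : cyclic_trace t -> cyclic_trace t' ->
  (forall f : hhom (preg H) (twist phi (preg H)), t (preg H) f = t' (preg H) f) ->
  forall P f, t P f = t' P f.
Proof.
move=> t_cyc t'_cyc tt' P f; rewrite !(cyclic_trace_dual_basis _ _ (pdualP (P := P))) //.
by apply: eq_bigr => i _; exact: tt'.
Qed.

Definition ctrace_def tau P (f : hhom P (twist phi P)) : K :=
  \sum_i tau (pdual (P := P) i (f (bvec i))).
Fact ctrace_lin tau P : scalar (@ctrace_def tau P).
Proof.
move=> k f f'; rewrite /ctrace_def mulr_sumr -big_split; apply: eq_bigr => i _.
by rewrite (lin_hfun (bvec i) k f f') !linearP.
Qed.
HB.instance Definition _ tau P := GRing.isLinear.Build K (hhom P (twist phi P)) K *%R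
  (@ctrace_def tau P) (@ctrace_lin tau P).
Definition ctrace tau : trace_family phi := fun P => @ctrace_def tau P.

Lemma ctrace_dual_basis tau P (I : finType) (p : I -> P) (pi : I -> hhom P (hreg H))
    (f : hhom P (twist phi P)) :
  twisted_cyclic tau -> dual_basis p pi -> ctrace tau _ f = \sum_i tau (pi i (f (p i))).
Proof.
move=> tau_cyc pP; have := dual_basis_swap f (hid P) tau_cyc (pdualP (P := P)) pP.
by under eq_bigr do rewrite id_lfunE; under [in RHS]eq_bigr do rewrite id_lfunE.
Qed.

Lemma ctrace_cyclic tau : twisted_cyclic tau -> cyclic_trace (ctrace tau).
Proof.
move=> tau_cyc P P' f h.
have E := dual_basis_swap f h tau_cyc (pdualP (P := P)) (pdualP (P := P')).
apply: etrans (etrans _ E) _; apply: eq_bigr => i _; congr (tau (pdual i _)); by rewrite hcompE.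
Qed.

Lemma ctrace_preg tau (f : hhom (preg H) (twist phi (preg H))) : twisted_cyclic tau ->
  ctrace tau _ f = tau (f (1 : H)).
Proof.
move=> tau_cyc; rewrite (@ctrace_dual_basis tau (preg H) _ _ _ f tau_cyc (@dual_basis_preg K H)).
by rewrite (big_pred1 tt) => [|[]] //; rewrite id_lfunE.
Qed.

Lemma trace_form_ctrace tau x : twisted_cyclic tau -> trace_form (ctrace tau) x = tau x.
Proof.
move=> tau_cyc; rewrite [LHS](ctrace_preg _ tau_cyc) genmapE tregE.
by rewrite rmorph1 mul1r.
Qed.

(** The morphisms P -> P' and P' -> P that factor through H already detect every
  coordinate of f, respectively of h. *)
Lemma cyclic_trace_nondegenerate t : cyclic_trace t ->
  (forall x, (forall b, trace_form t (x * b) = 0) -> x = 0) ->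
  (forall x, (forall b, trace_form t (b * x) = 0) -> x = 0) ->
  nondegenerate_trace t.
Proof.
move=> t_cyc ndl ndr P P'; split=> [f f0 | h f0]; apply: hhom_eq => u.
  rewrite -[f u in LHS](pdualP (P := P)) [RHS]zero_lfunE big1 // => i _.
  suff -> : pdual i (f u) = 0 by rewrite (linD (@hact_lin _ _ P)) zero_lfunE.
  apply: ndl => b.
  have := f0 (genmap (hact P' b u) \oh pdual (P := P) i).
  have -> : f \oh (genmap (hact P' b u) \oh pdual (P := P) i)
      = (f \oh genmap (hact P' b u)) \oh pdual (P := P) i.
    by apply: hhom_eq => v; rewrite !hcompE.
  rewrite (t_cyc P (preg H)) trace_formE !hcompE genmapE hact1 id_lfunE (hfunE f).
  by rewrite (hfunE (pdual i)) hregE trace_form_cyclic.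
rewrite -[h u in LHS](pdualP (P := P')) [RHS]zero_lfunE big1 // => j _.
suff -> : pdual j (h u) = 0 by rewrite (linD (@hact_lin _ _ P')) zero_lfunE.
apply: ndr => b.
pose G : hhom (hreg H) (twist phi P) := genmap (hact P b u : twist phi P).
have := f0 (G \oh pdual (P := P') j).
have -> : G \oh pdual (P := P') j \oh h = G \oh (pdual (P := P') j \oh h).
  by apply: hhom_eq => v; rewrite !hcompE.
rewrite (t_cyc P (preg H)) trace_formE !hcompE genmapE hact1 id_lfunE.
by rewrite twisthE hcompE (hfunE h) (hfunE (pdual j)) hregE.
Qed.

End CyclicTraces.

(** * Right module traces and right integrals *)

Section RightCovector.
Variables (K : fieldType) (H : hopfAlgType K) (g : pivotal H).
Implicit Types (M V : hmod H) (P : pmod H) (tau : {scalar H}).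
Notation S := (antipode : 'End(H)).

(** The coordinate at xi of an element of H (x) V, for the isomorphism
  a (x) v |-> a_1 (x) a_2 v from the free module on the vector space V. *)
Definition rfree_coord_fun V (xi : dual V) : 'Hom(tens (hreg H) V, hreg H) :=
  tlift (fun (a : H) v => \sw_(x, y <- a) ((xi (hact V (S y) v) : K) *: x)).

Lemma rfree_coord_funE V (xi : dual V) (a : H) v :
  rfree_coord_fun xi (pure a v) = \sw_(x, y <- a) ((xi (hact V (S y) v) : K) *: x).
Proof. by rewrite /rfree_coord_fun tliftE //; hlin. Qed.

(** The H-linearity of the coordinate maps: S applied to a_1 produces a factor S a_2
  that cancels against the action of a_3 on v. *)
Lemma rfree_coord_swM V (xi : dual V) (a b : H) v :
  \sw_(h, z <- a) \sw_(x, y <- h * b) ((xi (hact V (S y) (hact V z v)) : K) *: x)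
    = a * \sw_(x, y <- b) ((xi (hact V (S y) v) : K) *: x).
Proof.
transitivity (\sw_(h, z <- a) \sw_(x, y <- h) \sw_(p, q <- b)
    ((xi (hact V (S q * (S y * z)) v) : K) *: (x * p))).
  apply: eq_sw => h z; rewrite swM; [|by hlin..].
  apply: eq_sw => x y; apply: eq_sw => p q.
  by rewrite antipodeM mulrA !hactM !comp_lfunE.
rewrite (swA (t := fun x y z => \sw_(p, q <- b)
    ((xi (hact V (S q * (S y * z)) v) : K) *: (x * p)))); [|by hlin..].
rewrite -(sw_counitr (f := fun a => a * \sw_(x, y <- b) ((xi (hact V (S y) v) : K) *: x)));
  last by hlin.
apply: eq_sw => x u.
rewrite (sw_antipodel (f := fun r => \sw_(p, q <- b)
    ((xi (hact V (S q * r) v) : K) *: (x * p)))); last by hlin.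
congr (_ *: _); rewrite (@sw_push _ _ _ _ b (fun c => x * c)); last by hlin.
by apply: eq_sw => p q; rewrite mulr1 scalerAr.
Qed.

Fact rfree_coord_subproof V (xi : dual V) a T :
  rfree_coord_fun xi (hact (htens (hreg H) V) a T) = hact (hreg H) a (rfree_coord_fun xi T).
Proof.
apply: (tens_hom (L := hreg H)) a T => a b v; rewrite sw_hom hregE rfree_coord_funE.
apply: etrans (rfree_coord_swM xi a b v); apply: eq_sw => h z.
by rewrite rfree_coord_funE hregE.
Qed.
Definition rfree_coord V (xi : dual V) : hhom (htens (hreg H) V) (hreg H) :=
  @mkhom _ _ (htens (hreg H) V) (hreg H) (rfree_coord_fun xi) (rfree_coord_subproof xi).

Lemma rfree_coordE V (xi : dual V) (a : H) v :
  rfree_coord xi (pure a v) = \sw_(x, y <- a) ((xi (hact V (S y) v) : K) *: x).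
Proof. exact: rfree_coord_funE. Qed.

(** The sum is a_1 m (x) a_2 S a_3 v. For M = H and m = 1 this says that the 1 (x) w_i
  and the coordinates at the xi_i form a dual basis of H (x) V; a general M allows to
  treat P (x) V by composing with a dual basis of P. *)
Lemma rfree_coord_basis M V (I : finType) (w : I -> V) (xi : I -> dual V) a (m : M) v :
  (forall u, \sum_i (xi i u : K) *: w i = u) ->
  \sum_i hact (htens M V) (rfree_coord (xi i) (pure (a : hreg H) v)) (pure m (w i))
    = pure (hact M a m) v.
Proof.
move=> wP.
transitivity (\sum_i \sw_(x, y <- a)
    ((xi i (hact V (S y) v) : K) *: hact (htens M V) x (pure m (w i)))).
  apply: eq_bigr => i _; rewrite rfree_coordE.
  rewrite (@sw_push _ _ _ _ a (fun r => hact (htens M V) r (pure m (w i)))); last by hlin.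
  apply: eq_sw => x y.
  by rewrite (linD (f := fun r => hact (htens M V) r (pure m (w i)))) //; hlin.
transitivity (\sw_(x, y <- a) \sw_(p, q <- x) pure (hact M p m) (hact V (q * S y) v)).
  rewrite -sw_sum; apply: eq_sw => x y.
  transitivity (hact (htens M V) x (pure m (hact V (S y) v))); last first.
    by rewrite htensE; apply: eq_sw => p q; rewrite hactM comp_lfunE.
  rewrite -{2}[hact V (S y) v]wP.
  rewrite (lin_fin_sum (f := fun u => hact (htens M V) x (pure m u))); last by hlin.
  apply: eq_bigr => i _.
  by rewrite (linD (f := fun u => hact (htens M V) x (pure m u))) //; hlin.
rewrite (swA (t := fun p q y => pure (hact M p m) (hact V (q * S y) v))); [|by hlin..].
rewrite -(sw_counitr (f := fun a => pure (hact M a m) v)); last by hlin.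
apply: eq_sw => p u.
rewrite (sw_antipoder (f := fun r => pure (hact M p m) (hact V r v))); last by hlin.
by rewrite hact1 id_lfunE.
Qed.

(** The pivotal pairing with xi in the last factor, from which the right partial
  trace is built. *)
Definition reval V (M : vectType K) (xi : dual V) : 'Hom(tens M V, M) :=
  tlift (fun m v => (xi (hact V g v) : K) *: m).

Lemma revalE V (M : vectType K) (xi : dual V) (m : M) v :
  reval M xi (pure m v) = (xi (hact V g v) : K) *: m.
Proof. by rewrite /reval tliftE //; hlin. Qed.

Lemma lin_reval V (M : vectType K) T : linear (fun xi : dual V => reval M xi T).
Proof. by rewrite /reval; apply: lin_tlift => m v; hlin. Qed.

Lemma reval_tmap V (M N : vectType K) (h : 'Hom(M, N)) (xi : dual V) T :
  h (reval M xi T) = reval N xi (tmap h \1%VF T).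
Proof.
rewrite -!comp_lfunE; congr (fun_of_lfun _ T); apply: tens_eq => m v.
by rewrite !comp_lfunE tmapE !revalE id_lfunE linearZ.
Qed.

Lemma right_ptraceE (phi : right_twist H) (P V : hmod H)
    (f : hhom (htens P V) (twist phi (htens P V))) p :
  right_ptrace g f p = \sum_j reval P (@bcovec K V j) (f (pure p (bvec j))).
Proof.
rewrite /right_ptrace !hcompE [hrunitV P p]trunitVE [htmap (hid P) _ _]tmapE.
rewrite id_lfunE [hcoev V _]tcoevE scale1r.
rewrite (@linS _ _ _ (fun T => hrunit (twist phi P)
  (htmap (hid (twist phi P)) (hevt g V) (hassoc (twist phi P) V (hdual V)
   (htmap (rtw_cast f) (hid (hdual V)) (hassocV P V (hdual V) (pure p T)))))));
  last by hlin.
apply: eq_bigr => j _.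
rewrite [hassocV _ _ _ _]tassocVE [htmap (rtw_cast f) _ _]tmapE id_lfunE.
have -> : rtw_cast f (pure p (bvec j)) = f (pure p (bvec j)) by [].
move: (f _) => T.
transitivity (trunit P (tmap \1%VF (tevt g V) (tassoc P V (dual V) (pure T (bcovec j))))).
  by [].
move: T; apply: tens_lin_eq => [||q v]; try by hlin.
by rewrite tassocE tmapE id_lfunE tevtE trunitE revalE.
Qed.

End RightCovector.

Section RightTraces.
Variables (K : fieldType) (H : hopfAlgType K) (g : pivotal H) (phi : right_twist H).
Implicit Types (M V : hmod H) (P : pmod H) (tau : {scalar H}) (t : trace_family phi).
Notation S := (antipode : 'End(H)).

(** The module axiom, in the form that it takes for endomorphisms of H (x) V that
  factor through the coordinate at xi. *)
Definition right_compatible tau := forall V (xi : dual V) (T : tens (hreg H) V),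
  tau (rfree_coord xi T) = tau (reval g (hreg H) xi T).

Lemma module_trace_right_compatible t : right_module_trace g t -> right_compatible (trace_form t).
Proof.
case=> t_cyc t_mod V xi T.
pose f : hhom (ptensr (preg H) V) (twist phi (ptensr (preg H) V)) :=
  genmap (T : twist phi (htens (hreg H) V)) \oh rfree_coord xi.
have := t_mod (preg H) V f; rewrite (t_cyc _ (preg H)) !trace_formE right_ptraceE hcompE.
rewrite genmapE hact1 id_lfunE twisthE => ->; congr (trace_form t _).
transitivity (\sum_j (xi (bvec j) : K) *: reval g (hreg H) (bcovec j) T).
  apply: eq_bigr => j _; rewrite hcompE genmapE rfree_coordE sw1; [|by hlin..].
  rewrite antipode1 hact1 id_lfunE.
  transitivity (reval g (hreg H) (bcovec j) ((xi (bvec j) : K) *: T)); last by rewrite linearZ.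
  congr (reval _ _ _ _); rewrite (linD (@hact_lin _ _ _)) hact1.
  by rewrite scale_lfunE id_lfunE.
rewrite [xi in RHS](_ : xi = \sum_j (xi (bvec j) : K) *: @bcovec K V j).
  rewrite (linS (lin_reval g T)); apply: eq_bigr => j _.
  by rewrite (linD (lin_reval g T)).
apply/lfunP=> v; rewrite {1}[v]bvecE linear_sum sum_lfunE; apply: eq_bigr => j _.
by rewrite linearZ scale_lfunE bcovecE [RHS]mulrC.
Qed.

(** The trace of f is computed with the dual basis of P (x) V obtained from those of P
  and V; compatibility turns each coordinate into a partial trace. *)
Lemma right_compatible_module_trace t :
  cyclic_trace t -> right_compatible (trace_form t) -> right_module_trace g t.
Proof.
move=> t_cyc tauP; split=> // P V f.
pose p (ij : 'I_(\dim {:P}) * 'I_(\dim {:V})) : htens P V := pure (bvec ij.1) (bvec ij.2).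
pose pi (ij : 'I_(\dim {:P}) * 'I_(\dim {:V})) : hhom (htens P V) (hreg H) :=
  rfree_coord (@bcovec K V ij.2) \oh htmap (pdual (P := P) ij.1) (hid V).
have bP : dual_basis p pi.
  move=> T; rewrite -[RHS]id_lfunE; move: T.
  apply: tens_lin_eq => [||x v]; [by hlin | exact: linearP |].
  rewrite id_lfunE.
  transitivity (\sum_i \sum_j hact (htens P V)
      (rfree_coord (@bcovec K V j) (htmap (pdual (P := P) i) (hid V) (pure x v)))
      (pure (bvec i) (bvec j))).
    by rewrite pair_bigA; apply: eq_bigr => ij _; rewrite /pi hcompE.
  transitivity (\sum_i pure (hact P (pdual (P := P) i x) (bvec i)) v); last first.
    by rewrite -(linS (pure_linl v)) pdualP.
  apply: eq_bigr => i _; rewrite -(rfree_coord_basis _ _ _ (@bcovec_sum K V)).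
  by apply: eq_bigr => j _; rewrite [htmap _ _ _]tmapE id_lfunE.
rewrite (@cyclic_trace_dual_basis _ _ _ t (ptensr P V) _ p pi f t_cyc bP).
rewrite (cyclic_trace_dual_basis _ t_cyc (pdualP (P := P))).
transitivity (\sum_i \sum_j trace_form t (rfree_coord (@bcovec K V j)
    (htmap (pdual (P := P) i) (hid V) (f (pure (bvec i) (bvec j)))))).
  by rewrite pair_bigA; apply: eq_bigr => ij _; rewrite /pi hcompE.
apply: eq_bigr => i _; rewrite right_ptraceE !linear_sum; apply: eq_bigr => j _.
rewrite tauP /=; congr (trace_form t _).
by rewrite reval_tmap.
Qed.

Definition mul_form tau (b : H) : {scalar H} :=
  mkform (lin_scalar tau (lin_mulr b (@lin_id K H))).

Arguments mul_form : simpl never.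

Lemma mul_formE tau b x : mul_form tau b x = tau (b * x).
Proof. by []. Qed.

(** On pure tensors x (x) v, compatibility says that tau x_1 xi (S x_2 v) =
  tau x xi (g v). As xi and v are arbitrary, this is tau x_1 S x_2 = tau x g, and
  applying S^-1 and substituting x = g^-1 y gives the integral property. *)
Lemma right_compatibleP tau : right_compatible tau <-> right_integral (mul_form tau (g : H)^-1).
Proof.
have gK x : (g : H) * ((g : H)^-1 * x) = x by rewrite mulrA divrr ?pivot_unit // mul1r.
have gVK x : (g : H)^-1 * ((g : H) * x) = x by rewrite mulKr ?pivot_unit.
suff: right_compatible tau <-> forall x, \sw_(p, q <- x) (tau p *: S q) = tau x *: (g : H).
  move=> tauP; apply: iff_trans tauP _; split=> tauP a.
    rewrite -[a in LHS]gK sw_pivotl; [|by hlin..].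
    transitivity ((g : H) * antipodeV g (\sw_(p, q <- (g : H)^-1 * a) (tau p *: S q))).
      rewrite (@sw_push _ _ _ _ _ (fun u => (g : H) * antipodeV g u)); last by hlin.
      apply: eq_sw => p q; rewrite !mul_formE gVK (linD (antipodeV_linear g)) antipodeK.
      by rewrite scalerAr.
    rewrite tauP (linD (antipodeV_linear g)) antipodeV_pivot.
    by rewrite -scalerAr divrr ?pivot_unit.
  transitivity (\sw_(p, q <- (g : H) * a) (mul_form tau (g : H)^-1 p *: S ((g : H)^-1 * q))).
    rewrite sw_pivotl; [|by hlin..].
    by apply: eq_sw => p q; rewrite mul_formE !gVK.
  transitivity (S ((g : H)^-1 * \sw_(p, q <- (g : H) * a) (mul_form tau (g : H)^-1 p *: q))).
    rewrite (@sw_push _ _ _ _ _ (fun u => S ((g : H)^-1 * u))); last by hlin.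
    by apply: eq_sw => p q; rewrite -scalerAr linearZ.
  rewrite tauP mul_formE gVK -scalerAr mulr1 linearZ; congr (_ *: _).
  exact: antipode_pivotV.
have tau_sw (U : vectType K) (e : U -> K^o) (le : linear e) (f : H -> U) (lf : linear f) x :
    tau (\sw_(p, q <- x) ((e (f (S q)) : K) *: p)) = e (f (\sw_(p, q <- x) (tau p *: S q))).
  have ltau : linear (tau : H -> K^o) by move=> k u v; rewrite linearP.
  apply: etrans (@sw_push _ _ _ _ x (tau : H -> K^o) _ ltau) _.
  apply: etrans _ (esym (@sw_push _ _ _ _ x (fun u => e (f u)) _ (lin_comp le lf))).
  apply: eq_sw => p q; rewrite (linD lf) (linD le) linearZ; exact: mulrC.
split=> [tauP x | tauP V xi T].
  apply: form_eq => e.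
  have le : linear (e : H -> K^o) by move=> k u v; rewrite linearP.
  pose xi : dual (hreg H) := linfun (e : H -> K^o).
  have xiE u : xi u = e u by apply: linfunE.
  have := tauP (hreg H) xi (pure (x : hreg H) (1 : H)).
  rewrite rfree_coordE revalE (tau_sw _ xi (linearP xi) (fun a => hact (hreg H) a 1)); last by hlin.
  rewrite !hregE !mulr1 !xiE !linearZ => ->; exact: mulrC.
move: T; apply: (@tens_lin_eq _ _ _ (triv K)) => [k u w|k u w|x v]; rewrite ?linearP //.
rewrite rfree_coordE revalE (tau_sw _ xi (linearP xi) (fun a => hact V a v)); last by hlin.
rewrite tauP (linD (@hact_lin _ _ V)) scale_lfunE !linearZ; exact: mulrC.
Qed.


Variables (alpha : {lrmorphism H -> K | *%R}) (c : H).
Hypothesis c_left : left_cointegral c.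
Hypothesis c_right : forall a, c * a = alpha a *: c.
Hypothesis c_neq0 : c != 0.

Lemma mul_formVK (h : H) tau x : h \is a GRing.unit -> mul_form (mul_form tau h) h^-1 x = tau x.
Proof. by move=> hu; rewrite !mul_formE mulVKr. Qed.

Lemma right_integral_cyclic mu : right_integral mu -> phi =1 Rmap alpha ->
  twisted_cyclic phi (mul_form mu g).
Proof.
move=> mu_int phiE x y; rewrite !mul_formE phiE.
rewrite [in RHS]mulrA -(right_integral_nakayama g c_left c_right c_neq0 y ((g : H) * x)) //.
by rewrite (pivot_antipode2 g) !mulrA mulrVK ?pivot_unit.
Qed.

(** By cyclicity and the Nakayama formula, mu (S^2 (phi y) * x) = mu (S^2 (R(alpha) y) * x)
  for all x, and mu is non-degenerate. *)
Lemma right_integral_modulus mu : right_integral mu -> mu c != 0 ->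
  twisted_cyclic phi (mul_form mu g) -> phi =1 Rmap alpha.
Proof.
move=> mu_int muc0 mu_cyc y; apply: (antipode_inj g); apply: (antipode_inj g).
apply/eqP; rewrite -subr_eq0; apply/eqP.
apply: (right_integral_nondeg g c_left mu_int muc0) => x.
rewrite mulrBl linearB /= (right_integral_nakayama g c_left c_right c_neq0) //.
rewrite (pivot_antipode2 g) -!mulrA -[mu ((g : H) * _)]/(mul_form mu g _) mu_cyc.
by rewrite mul_formE !mulrA divrr ?pivot_unit // mul1r subrr.
Qed.

Lemma right_module_trace_integral t : right_module_trace g t ->
  exists2 mu : {scalar H}, right_integral mu & trace_form t =1 mul_form mu g.
Proof.
move=> t_mod; exists (mul_form (trace_form t) (g : H)^-1).
  by apply/right_compatibleP; apply: module_trace_right_compatible.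
by move=> x; rewrite !mul_formE mulrA mulVr ?pivot_unit // mul1r.
Qed.

Lemma integral_right_module_trace mu : right_integral mu -> phi =1 Rmap alpha ->
  right_module_trace g (ctrace phi (mul_form mu g)).
Proof.
move=> mu_int phiE; have mu_cyc := right_integral_cyclic mu_int phiE.
apply: right_compatible_module_trace; first exact: ctrace_cyclic.
move=> V xi T; rewrite !trace_form_ctrace //; move: V xi T.
apply/right_compatibleP => a; rewrite (mul_formVK _ _ (pivot_unit g)).
by rewrite -mu_int; apply: eq_sw => x y; rewrite (mul_formVK _ _ (pivot_unit g)).
Qed.

End RightTraces.

(** * Left module traces and left integrals *)

Section LeftCovector.
Variables (K : fieldType) (H : hopfAlgType K) (g : pivotal H).
Implicit Types (M V : hmod H) (P : pmod H) (tau : {scalar H}).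
Notation SV := (antipodeV g).

(** The coordinate at xi of an element of V (x) H, for the isomorphism
  v (x) a |-> a_1 v (x) a_2 from the free module on the vector space V. *)
Definition lfree_coord_fun V (xi : dual V) : 'Hom(tens V (hreg H), hreg H) :=
  tlift (fun v (a : H) => \sw_(x, y <- a) ((xi (hact V (SV x) v) : K) *: y)).

Lemma lfree_coord_funE V (xi : dual V) (a : H) v :
  lfree_coord_fun xi (pure v a) = \sw_(x, y <- a) ((xi (hact V (SV x) v) : K) *: y).
Proof. by rewrite /lfree_coord_fun tliftE //; hlin. Qed.

(** As for rfree_coord_swM, with S^-1 a_2 cancelling against a_1. *)
Lemma lfree_coord_swM V (xi : dual V) (a b : H) v :
  \sw_(z, h <- a) \sw_(x, y <- h * b) ((xi (hact V (SV x) (hact V z v)) : K) *: y)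
    = a * \sw_(x, y <- b) ((xi (hact V (SV x) v) : K) *: y).
Proof.
transitivity (\sw_(z, h <- a) \sw_(x, y <- h) \sw_(p, q <- b)
    ((xi (hact V (SV p * (SV x * z)) v) : K) *: (y * q))).
  apply: eq_sw => z h; rewrite swM; [|by hlin..].
  apply: eq_sw => x y; apply: eq_sw => p q.
  by rewrite antipodeVM mulrA !hactM !comp_lfunE.
rewrite -(swA (t := fun z x y => \sw_(p, q <- b)
    ((xi (hact V (SV p * (SV x * z)) v) : K) *: (y * q)))); [|by hlin..].
rewrite -(sw_counitl (f := fun a => a * \sw_(x, y <- b) ((xi (hact V (SV x) v) : K) *: y)));
  last by hlin.
apply: eq_sw => u y.
rewrite (sw_antipodeVl g (f := fun r => \sw_(p, q <- b)
    ((xi (hact V (SV p * r) v) : K) *: (y * q)))); last by hlin.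
congr (_ *: _); rewrite (@sw_push _ _ _ _ b (fun c => y * c)); last by hlin.
by apply: eq_sw => p q; rewrite mulr1 scalerAr.
Qed.

Fact lfree_coord_subproof V (xi : dual V) a T :
  lfree_coord_fun xi (hact (htens V (hreg H)) a T) = hact (hreg H) a (lfree_coord_fun xi T).
Proof.
apply: (tens_hom (L := hreg H)) a T => a v b; rewrite sw_hom hregE lfree_coord_funE.
apply: etrans (lfree_coord_swM xi a b v); apply: eq_sw => z h.
by rewrite lfree_coord_funE hregE.
Qed.
Definition lfree_coord V (xi : dual V) : hhom (htens V (hreg H)) (hreg H) :=
  @mkhom _ _ (htens V (hreg H)) (hreg H) (lfree_coord_fun xi) (lfree_coord_subproof xi).

Lemma lfree_coordE V (xi : dual V) (a : H) v :
  lfree_coord xi (pure v a) = \sw_(x, y <- a) ((xi (hact V (SV x) v) : K) *: y).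
Proof. exact: lfree_coord_funE. Qed.

Lemma lfree_coord_basis M V (I : finType) (w : I -> V) (xi : I -> dual V) a (m : M) v :
  (forall u, \sum_i (xi i u : K) *: w i = u) ->
  \sum_i hact (htens V M) (lfree_coord (xi i) (pure v (a : hreg H))) (pure (w i) m)
    = pure v (hact M a m).
Proof.
move=> wP.
transitivity (\sum_i \sw_(x, y <- a)
    ((xi i (hact V (SV x) v) : K) *: hact (htens V M) y (pure (w i) m))).
  apply: eq_bigr => i _; rewrite lfree_coordE.
  rewrite (@sw_push _ _ _ _ a (fun r => hact (htens V M) r (pure (w i) m))); last by hlin.
  apply: eq_sw => x y.
  by rewrite (linD (f := fun r => hact (htens V M) r (pure (w i) m))) //; hlin.
transitivity (\sw_(x, y <- a) \sw_(p, q <- y) pure (hact V (p * SV x) v) (hact M q m)).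
  rewrite -sw_sum; apply: eq_sw => x y.
  transitivity (hact (htens V M) y (pure (hact V (SV x) v) m)); last first.
    by rewrite htensE; apply: eq_sw => p q; rewrite hactM comp_lfunE.
  rewrite -{2}[hact V (SV x) v]wP.
  rewrite (lin_fin_sum (f := fun u => hact (htens V M) y (pure u m))); last by hlin.
  apply: eq_bigr => i _.
  by rewrite (linD (f := fun u => hact (htens V M) y (pure u m))) //; hlin.
rewrite -(swA (t := fun x p q => pure (hact V (p * SV x) v) (hact M q m))); [|by hlin..].
rewrite -(sw_counitl (f := fun a => pure v (hact M a m))); last by hlin.
apply: eq_sw => u q.
rewrite (sw_antipodeVr g (f := fun r => pure (hact V r v) (hact M q m))); last by hlin.
by rewrite hact1 id_lfunE.
Qed.

Definition leval (V : vectType K) (M : vectType K) (xi : dual V) : 'Hom(tens V M, M) :=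
  tlift (fun v m => (xi v : K) *: m).

Lemma levalE (V : vectType K) (M : vectType K) (xi : dual V) (m : M) v :
  leval M xi (pure v m) = (xi v : K) *: m.
Proof. by rewrite /leval tliftE //; hlin. Qed.

Lemma lin_leval (V : vectType K) (M : vectType K) T : linear (fun xi : dual V => leval M xi T).
Proof. by rewrite /leval; apply: lin_tlift => m v; hlin. Qed.

Lemma leval_tmap (V : vectType K) (M N : vectType K) (h : 'Hom(M, N)) (xi : dual V) T :
  h (leval M xi T) = leval N xi (tmap \1%VF h T).
Proof.
rewrite -!comp_lfunE; congr (fun_of_lfun _ T); apply: tens_eq => m v.
by rewrite !comp_lfunE tmapE !levalE id_lfunE linearZ.
Qed.

Lemma left_ptraceE (phi : left_twist H) (V P : hmod H)
    (f : hhom (htens V P) (twist phi (htens V P))) p :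
  left_ptrace g f p =
    \sum_j leval P (@bcovec K V j) (f (pure (hact V (g : H)^-1 (bvec j)) p)).
Proof.
rewrite /left_ptrace !hcompE [hlunitV P p]tlunitVE [htmap (hcoevt _ _) _ _]tmapE.
rewrite id_lfunE [hcoevt g V _]tcoevtE scale1r.
rewrite (@linS _ _ _ (fun T => hlunit (twist phi P)
  (htmap (hev V) (hid (twist phi P)) (hassocV (hdual V) V (twist phi P)
   (htmap (hid (hdual V)) (ltw_cast f) (hassoc (hdual V) V P (pure T p)))))));
  last by hlin.
apply: eq_bigr => j _.
rewrite [hassoc _ _ _ _]tassocE [htmap (hid _) (ltw_cast f) _]tmapE id_lfunE.
have -> : ltw_cast f (pure (hact V (g : H)^-1 (bvec j)) p)
  = f (pure (hact V (g : H)^-1 (bvec j)) p) by [].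
move: (f _) => T.
transitivity (tlunit P (tmap (tev V) \1%VF (tassocV (dual V) V P (pure (bcovec j) T)))).
  by [].
move: T; apply: tens_lin_eq => [||v q]; try by hlin.
by rewrite tassocVE tmapE id_lfunE tevE tlunitE levalE.
Qed.

End LeftCovector.

Section LeftTraces.
Variables (K : fieldType) (H : hopfAlgType K) (g : pivotal H) (phi : left_twist H).
Implicit Types (M V : hmod H) (P : pmod H) (tau : {scalar H}) (t : trace_family phi).
Notation S := (antipode : 'End(H)).
Notation SV := (antipodeV g).

Definition left_compatible tau := forall V (xi : dual V) (T : tens V (hreg H)),
  tau (lfree_coord g xi T) = tau (leval (hreg H) (xi \o hact V ((g : H)^-1)%R)%VF T).

Lemma module_trace_left_compatible t : left_module_trace g t -> left_compatible (trace_form t).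
Proof.
case=> t_cyc t_mod V xi T.
pose f : hhom (ptensl g V (preg H)) (twist phi (ptensl g V (preg H))) :=
  genmap (T : twist phi (htens V (hreg H))) \oh lfree_coord g xi.
have := t_mod V (preg H) f; rewrite (t_cyc _ (preg H)) !trace_formE left_ptraceE hcompE.
rewrite genmapE hact1 id_lfunE twisthE => ->; congr (trace_form t _).
set eta := (xi \o _)%VF.
transitivity (\sum_j (eta (bvec j) : K) *: leval (hreg H) (bcovec j) T).
  apply: eq_bigr => j _; rewrite hcompE genmapE lfree_coordE sw1; [|by hlin..].
  rewrite antipodeV1 hact1 id_lfunE.
  transitivity (leval (hreg H) (bcovec j) ((eta (bvec j) : K) *: T)); last by rewrite linearZ.
  congr (leval _ _ _); rewrite (linD (@hact_lin _ _ _)) hact1.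
  by rewrite scale_lfunE id_lfunE comp_lfunE.
rewrite [eta in RHS](_ : eta = \sum_j (eta (bvec j) : K) *: @bcovec K V j).
  rewrite (linS (lin_leval T)); apply: eq_bigr => j _.
  by rewrite (linD (lin_leval T)).
apply/lfunP=> v; rewrite {1}[v]bvecE linear_sum sum_lfunE; apply: eq_bigr => j _.
by rewrite linearZ scale_lfunE bcovecE [RHS]mulrC.
Qed.

Lemma left_compatible_module_trace t :
  cyclic_trace t -> left_compatible (trace_form t) -> left_module_trace g t.
Proof.
move=> t_cyc tauP; split=> // V P f.
(* The left partial trace contains the vectors g^-1 v_j; they are used as the basis of
   V, with dual basis v_j^* o g. *)
pose w j := hact V (g : H)^-1 (@bvec K V j).
pose xi j : dual V := (@bcovec K V j \o hact V g)%VF.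
have wP u : \sum_j (xi j u : K) *: w j = u.
  rewrite -[RHS](id_lfunE) -(hact1 V) -(mulVr (pivot_unit g)) hactM comp_lfunE.
  rewrite -{1}[hact V g u]bcovec_sum linear_sum; apply: eq_bigr => j _.
  by rewrite linearZ comp_lfunE.
have xiK j : (xi j \o hact V ((g : H)^-1)%R)%VF = @bcovec K V j.
  by rewrite -comp_lfunA -hactM divrr ?pivot_unit // hact1 comp_lfun1r.
pose p (ij : 'I_(\dim {:P}) * 'I_(\dim {:V})) : htens V P := pure (w ij.2) (bvec ij.1).
pose pi (ij : 'I_(\dim {:P}) * 'I_(\dim {:V})) : hhom (htens V P) (hreg H) :=
  lfree_coord g (xi ij.2) \oh htmap (hid V) (pdual (P := P) ij.1).
have bP : dual_basis p pi.
  move=> T; rewrite -[RHS]id_lfunE; move: T.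
  apply: tens_lin_eq => [||v x]; [by hlin | exact: linearP |].
  rewrite id_lfunE.
  transitivity (\sum_i \sum_j hact (htens V P)
      (lfree_coord g (xi j) (htmap (hid V) (pdual (P := P) i) (pure v x)))
      (pure (w j) (bvec i))).
    by rewrite pair_bigA; apply: eq_bigr => ij _; rewrite /pi hcompE.
  transitivity (\sum_i pure v (hact P (pdual (P := P) i x) (bvec i))); last first.
    by rewrite -(linS (pure_linr v)) pdualP.
  apply: eq_bigr => i _; rewrite -(lfree_coord_basis g _ _ _ wP).
  by apply: eq_bigr => j _; rewrite [htmap _ _ _]tmapE id_lfunE.
rewrite (@cyclic_trace_dual_basis _ _ _ t (ptensl g V P) _ p pi f t_cyc bP).
rewrite (cyclic_trace_dual_basis _ t_cyc (pdualP (P := P))).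
transitivity (\sum_i \sum_j trace_form t (lfree_coord g (xi j)
    (htmap (hid V) (pdual (P := P) i) (f (pure (w j) (bvec i)))))).
  by rewrite pair_bigA; apply: eq_bigr => ij _; rewrite /pi hcompE.
apply: eq_bigr => i _; rewrite left_ptraceE !linear_sum; apply: eq_bigr => j _.
rewrite tauP xiK /=; congr (trace_form t _).
by rewrite leval_tmap.
Qed.

(** On v (x) x, compatibility says that tau x_2 S^-1 x_1 = tau x g^-1. *)
Lemma left_compatibleP tau : left_compatible tau <-> left_integral (mul_form tau g).
Proof.
have gK x : (g : H) * ((g : H)^-1 * x) = x by rewrite mulrA divrr ?pivot_unit // mul1r.
have gVK x : (g : H)^-1 * ((g : H) * x) = x by rewrite mulKr ?pivot_unit.
have lSV := antipodeV_linear g.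
have lS : linear (fun x => S x) by exact: linearP.
suff: left_compatible tau <-> forall x, \sw_(p, q <- x) (tau q *: SV p) = tau x *: (g : H)^-1.
  move=> tauP; apply: iff_trans tauP _; split=> tauP a.
    transitivity ((g : H)^-1 * S (\sw_(p, q <- (g : H) * a) (tau q *: SV p))).
      rewrite sw_pivotl; [|by hlin..].
      rewrite (@sw_push _ _ _ _ _ (fun u => (g : H)^-1 * S u)); last by hlin.
      apply: eq_sw => p q; rewrite (linD lS) antipodeVK mul_formE.
      by rewrite -scalerAr gVK.
    rewrite tauP (linD lS) antipode_pivotV -scalerAr mulVr ?pivot_unit //.
  rewrite -[a in LHS]gK sw_pivotl; [|by hlin..].
  transitivity (SV ((g : H) * \sw_(p, q <- (g : H)^-1 * a) (mul_form tau g q *: p))).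
    rewrite (@sw_push _ _ _ _ _ (fun u => SV ((g : H) * u))); last by hlin.
    by apply: eq_sw => p q; rewrite -scalerAr (linD lSV).
  by rewrite tauP mul_formE gK -scalerAr mulr1 (linD lSV) antipodeV_pivot.
have tau_sw (U : vectType K) (e : U -> K^o) (le : linear e) (f : H -> U) (lf : linear f) x :
    tau (\sw_(p, q <- x) ((e (f (SV p)) : K) *: q)) = e (f (\sw_(p, q <- x) (tau q *: SV p))).
  have ltau : linear (tau : H -> K^o) by move=> k u v; rewrite linearP.
  apply: etrans (@sw_push _ _ _ _ x (tau : H -> K^o) _ ltau) _.
  apply: etrans _ (esym (@sw_push _ _ _ _ x (fun u => e (f u)) _ (lin_comp le lf))).
  apply: eq_sw => p q; rewrite (linD lf) (linD le) linearZ; exact: mulrC.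
split=> [tauP x | tauP V xi T].
  apply: form_eq => e.
  have le : linear (e : H -> K^o) by move=> k u v; rewrite linearP.
  pose xi : dual (hreg H) := linfun (e : H -> K^o).
  have xiE u : xi u = e u by apply: linfunE.
  have := tauP (hreg H) xi (pure (1 : H) (x : hreg H)).
  rewrite lfree_coordE levalE (tau_sw _ xi (linearP xi) (fun a => hact (hreg H) a 1)); last by hlin.
  rewrite comp_lfunE !hregE !mulr1 !xiE !linearZ => ->; exact: mulrC.
move: T; apply: (@tens_lin_eq _ _ _ (triv K)) => [k u w|k u w|v x]; rewrite ?linearP //.
rewrite lfree_coordE levalE (tau_sw _ xi (linearP xi) (fun a => hact V a v)); last by hlin.
rewrite comp_lfunE tauP (linD (@hact_lin _ _ V)) scale_lfunE !linearZ; exact: mulrC.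
Qed.

Variables (alpha : {lrmorphism H -> K | *%R}) (c : H).
Hypothesis c_left : left_cointegral c.
Hypothesis c_right : forall a, c * a = alpha a *: c.
Hypothesis c_neq0 : c != 0.

Lemma left_integral_cyclic mu : left_integral mu -> phi =1 Lmap alpha ->
  twisted_cyclic phi (mul_form mu (g : H)^-1).
Proof.
move=> mu_int phiE x y; rewrite !mul_formE phiE.
rewrite [in RHS]mulrA -(left_integral_nakayama g c_left c_right c_neq0 y ((g : H)^-1 * x)) //.
by rewrite antipodeV2 !mulrA mulrK ?pivot_unit.
Qed.

Lemma left_integral_modulus mu : left_integral mu -> mu c != 0 ->
  twisted_cyclic phi (mul_form mu (g : H)^-1) -> phi =1 Lmap alpha.
Proof.
move=> mu_int muc0 mu_cyc y; apply: (can_inj (antipodeVK g)); apply: (can_inj (antipodeVK g)).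
apply/eqP; rewrite -subr_eq0; apply/eqP.
apply: (left_integral_nondeg g c_left mu_int muc0) => x.
rewrite mulrBl linearB /= (left_integral_nakayama g c_left c_right c_neq0) //.
rewrite antipodeV2 -!mulrA -[mu ((g : H)^-1 * _)]/(mul_form mu (g : H)^-1 _) mu_cyc.
by rewrite mul_formE !mulrA mulVr ?pivot_unit // mul1r subrr.
Qed.

Lemma left_module_trace_integral t : left_module_trace g t ->
  exists2 mu : {scalar H}, left_integral mu & trace_form t =1 mul_form mu (g : H)^-1.
Proof.
move=> t_mod; exists (mul_form (trace_form t) g).
  by apply/left_compatibleP; apply: module_trace_left_compatible.
by move=> x; rewrite (mul_formVK _ _ (pivot_unit g)).
Qed.

Lemma integral_left_module_trace mu : left_integral mu -> phi =1 Lmap alpha ->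
  left_module_trace g (ctrace phi (mul_form mu (g : H)^-1)).
Proof.
move=> mu_int phiE; have mu_cyc := left_integral_cyclic mu_int phiE.
apply: left_compatible_module_trace; first exact: ctrace_cyclic.
move=> V xi T; rewrite !trace_form_ctrace //; move: V xi T.
have muK x : mul_form (mul_form mu (g : H)^-1) g x = mu x.
  by rewrite !mul_formE mulKr ?pivot_unit.
by apply/left_compatibleP => a; rewrite muK -mu_int; apply: eq_sw => x y; rewrite muK.
Qed.

End LeftTraces.

(** * Spaces of module traces *)

Section RightSpace.
Variables (K : fieldType) (H : hopfAlgType K) (g : pivotal H) (phi : right_twist H).
Variables (alpha : {lrmorphism H -> K | *%R}).
Hypothesis alphaP : is_modulus alpha.
Implicit Types (t : trace_family phi) (mu : {scalar H}).

Lemma right_module_trace_integral_neq0 t : right_module_trace g t -> nonzero_trace t ->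
  forall c, c != 0 -> left_cointegral c ->
  exists mu : {scalar H}, [/\ right_integral mu, mu c != 0 & trace_form t =1 mul_form mu g].
Proof.
move=> t_mod t_neq0 c c0 cl; have [mu mu_int tE] := right_module_trace_integral t_mod.
have [t_cyc _] := t_mod; have [x tx0] := nonzero_trace_form t_cyc t_neq0.
exists mu; split=> //; apply: contraNneq tx0 => muc0.
by rewrite tE mul_formE (right_integral_eq0 g cl c0).
Qed.

Lemma right_module_trace_modulus t :
  right_module_trace g t -> nonzero_trace t -> phi =1 Rmap alpha.
Proof.
have [c [c0 cl cr]] := alphaP => t_mod t_neq0; have [t_cyc _] := t_mod.
have [mu [mu_int muc0 tE]] := right_module_trace_integral_neq0 t_mod t_neq0 c0 cl.
apply: (right_integral_modulus (g := g) cl cr c0 mu_int muc0) => x y.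
by rewrite -!tE; exact: trace_form_cyclic.
Qed.

Lemma right_module_trace_nondegenerate t :
  right_module_trace g t -> nonzero_trace t -> nondegenerate_trace t.
Proof.
move=> t_mod t_neq0; have phiE := right_module_trace_modulus t_mod t_neq0.
have [c [c0 cl cr]] := alphaP; have [t_cyc _] := t_mod.
have [mu [mu_int muc0 tE]] := right_module_trace_integral_neq0 t_mod t_neq0 c0 cl.
have ndl x : (forall b, trace_form t (x * b) = 0) -> x = 0.
  move=> x0; rewrite -[x](mulKr (pivot_unit g)).
  suff -> : (g : H) * x = 0 by rewrite mulr0.
  by apply: (right_integral_nondeg g cl mu_int muc0) => b; rewrite -mulrA -mul_formE -tE.
apply: cyclic_trace_nondegenerate => // x x0.
apply: (@Rmap_inj _ _ alpha); apply: ndl => b.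
by rewrite -phiE trace_form_cyclic.
Qed.

Lemma right_module_trace_dim1 : phi =1 Rmap alpha ->
  trace_space_dim1 (@right_module_trace K H g phi).
Proof.
move=> phiE; have [c [c0 cl cr]] := alphaP.
have [mu0 mu0_int mu0c] := right_integral_ex g cl c0.
have t0_mod := integral_right_module_trace g cl cr c0 mu0_int phiE.
have t0_cyc : twisted_cyclic phi (mul_form mu0 g) by apply: (right_integral_cyclic g cl cr c0).
exists (ctrace phi (mul_form mu0 g)).
  exists (preg H), (genmap (((g : H)^-1 * c) : twist phi (hreg H))).
  rewrite ctrace_preg // genmapE hact1 id_lfunE mul_formE mulVKr ?pivot_unit //.
  by rewrite mu0c oner_neq0.
move=> t; split=> [t_mod | [k tE]].
  have [mu mu_int tE] := right_module_trace_integral t_mod.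
  exists (mu c) => P f; have [t_cyc _] := t_mod.
  rewrite (cyclic_trace_dual_basis _ t_cyc (pdualP (P := P))).
  rewrite (ctrace_dual_basis _ t0_cyc (pdualP (P := P))) mulr_sumr.
  apply: eq_bigr => i _; rewrite tE !mul_formE.
  by rewrite -(right_integral_unique g cl c0 mu_int mu0_int) mu0c mul1r.
have [t0_c t0_p] := t0_mod; split=> [P P' f h | P V f]; rewrite !tE.
  by rewrite t0_c.
by rewrite t0_p.
Qed.

Lemma right_integral_trace mu : phi =1 Rmap alpha -> right_integral mu ->
  exists2 t : trace_family phi, right_module_trace g t /\
    (forall f : hhom (preg H) (twist phi (preg H)), t (preg H) f = mu ((g : H) * f (1 : H)))
  & forall t', right_module_trace g t' ->
    (forall f : hhom (preg H) (twist phi (preg H)), t' (preg H) f = mu ((g : H) * f (1 : H))) ->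
    forall P f, t' P f = t P f.
Proof.
move=> phiE mu_int; have [c [c0 cl cr]] := alphaP.
have t_mod := integral_right_module_trace g cl cr c0 mu_int phiE.
have tE (f : hhom (preg H) (twist phi (preg H))) :
    ctrace phi (mul_form mu g) (preg H) f = mu ((g : H) * f (1 : H)).
  by rewrite ctrace_preg //; apply: (right_integral_cyclic g cl cr c0).
exists (ctrace phi (mul_form mu g)) => // t' [t'_cyc _] t'E.
have [t_cyc _] := t_mod; apply: cyclic_trace_ext => // f.
by rewrite t'E tE.
Qed.

End RightSpace.

Section LeftSpace.
Variables (K : fieldType) (H : hopfAlgType K) (g : pivotal H) (phi : left_twist H).
Variables (alpha : {lrmorphism H -> K | *%R}).
Hypothesis alphaP : is_modulus alpha.
Implicit Types (t : trace_family phi) (mu : {scalar H}).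

Lemma left_module_trace_integral_neq0 t : left_module_trace g t -> nonzero_trace t ->
  forall c, c != 0 -> left_cointegral c ->
  exists mu : {scalar H}, [/\ left_integral mu, mu c != 0 & trace_form t =1 mul_form mu (g : H)^-1].
Proof.
move=> t_mod t_neq0 c c0 cl; have [mu mu_int tE] := left_module_trace_integral t_mod.
have [t_cyc _] := t_mod; have [x tx0] := nonzero_trace_form t_cyc t_neq0.
exists mu; split=> //; apply: contraNneq tx0 => muc0.
by rewrite tE mul_formE (left_integral_eq0 cl c0).
Qed.

Lemma left_module_trace_modulus t :
  left_module_trace g t -> nonzero_trace t -> phi =1 Lmap alpha.
Proof.
have [c [c0 cl cr]] := alphaP => t_mod t_neq0; have [t_cyc _] := t_mod.
have [mu [mu_int muc0 tE]] := left_module_trace_integral_neq0 t_mod t_neq0 c0 cl.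
apply: (left_integral_modulus (g := g) cl cr c0 mu_int muc0) => x y.
by rewrite -!tE; exact: trace_form_cyclic.
Qed.

Lemma left_module_trace_dim1 : phi =1 Lmap alpha ->
  trace_space_dim1 (@left_module_trace K H g phi).
Proof.
move=> phiE; have [c [c0 cl cr]] := alphaP.
have [mu0 mu0_int mu0c] := left_integral_ex cl c0.
have t0_mod := integral_left_module_trace g cl cr c0 mu0_int phiE.
have t0_cyc : twisted_cyclic phi (mul_form mu0 (g : H)^-1) by apply: (left_integral_cyclic g cl cr c0).
exists (ctrace phi (mul_form mu0 (g : H)^-1)).
  exists (preg H), (genmap (((g : H) * c) : twist phi (hreg H))).
  rewrite ctrace_preg // genmapE hact1 id_lfunE mul_formE mulKr ?pivot_unit //.
  by rewrite mu0c oner_neq0.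
move=> t; split=> [t_mod | [k tE]].
  have [mu mu_int tE] := left_module_trace_integral t_mod.
  exists (mu c) => P f; have [t_cyc _] := t_mod.
  rewrite (cyclic_trace_dual_basis _ t_cyc (pdualP (P := P))).
  rewrite (ctrace_dual_basis _ t0_cyc (pdualP (P := P))) mulr_sumr.
  apply: eq_bigr => i _; rewrite tE !mul_formE.
  by rewrite -(left_integral_unique cl c0 mu_int mu0_int) mu0c mul1r.
have [t0_c t0_p] := t0_mod; split=> [P P' f h | P V f]; rewrite !tE.
  by rewrite t0_c.
by rewrite t0_p.
Qed.

Lemma left_integral_trace mu : phi =1 Lmap alpha -> left_integral mu ->
  exists2 t : trace_family phi, left_module_trace g t /\
    (forall f : hhom (preg H) (twist phi (preg H)), t (preg H) f = mu ((g : H)^-1 * f (1 : H)))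
  & forall t', left_module_trace g t' ->
    (forall f : hhom (preg H) (twist phi (preg H)), t' (preg H) f = mu ((g : H)^-1 * f (1 : H))) ->
    forall P f, t' P f = t P f.
Proof.
move=> phiE mu_int; have [c [c0 cl cr]] := alphaP.
have t_mod := integral_left_module_trace g cl cr c0 mu_int phiE.
have tE (f : hhom (preg H) (twist phi (preg H))) :
    ctrace phi (mul_form mu (g : H)^-1) (preg H) f = mu ((g : H)^-1 * f (1 : H)).
  by rewrite ctrace_preg //; apply: (left_integral_cyclic g cl cr c0).
exists (ctrace phi (mul_form mu (g : H)^-1)) => // t' [t'_cyc _] t'E.
have [t_cyc _] := t_mod; apply: cyclic_trace_ext => // f.
by rewrite t'E tE.
Qed.

End LeftSpace.

(** * The classification *)

Theorem corollary6p1 (K : fieldType) (H : hopfAlgType K) (g : pivotal H)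
    (alpha : {lrmorphism H -> K | *%R}) (halpha : is_modulus alpha)
    (nu : {lrmorphism H -> K | *%R}) :
  [/\ nu =1 alpha -> trace_space_dim1 (@right_module_trace K H g (rtw_R nu)),
      ~ nu =1 alpha -> trace_space_trivial (@right_module_trace K H g (rtw_R nu)),
      forall t : trace_family (rtw_R alpha),
        right_module_trace g t -> nonzero_trace t -> nondegenerate_trace t,
      forall t : trace_family (rtw_R alpha), right_module_trace g t ->
        exists2 mu : {scalar H}, right_integral mu &
          forall f : hhom (preg H) (twist (rtw_R alpha) (preg H)),
            t (preg H) f = mu ((g : H) * f (1 : H))
    & forall mu : {scalar H}, right_integral mu ->
        exists2 t : trace_family (rtw_R alpha),
          right_module_trace g t /\
          (forall f : hhom (preg H) (twist (rtw_R alpha) (preg H)),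
             t (preg H) f = mu ((g : H) * f (1 : H)))
        & forall t' : trace_family (rtw_R alpha),
          right_module_trace g t' ->
          (forall f : hhom (preg H) (twist (rtw_R alpha) (preg H)),
             t' (preg H) f = mu ((g : H) * f (1 : H))) ->
          forall P f, t' P f = t P f] /\
  [/\ nu =1 alpha -> trace_space_dim1 (@left_module_trace K H g (ltw_L nu)),
      ~ nu =1 alpha -> trace_space_trivial (@left_module_trace K H g (ltw_L nu)),
      forall t : trace_family (ltw_L alpha), left_module_trace g t ->
        exists2 mu : {scalar H}, left_integral mu &
          forall f : hhom (preg H) (twist (ltw_L alpha) (preg H)),
            t (preg H) f = mu ((g : H)^-1 * f (1 : H))
    & forall mu : {scalar H}, left_integral mu ->
        exists2 t : trace_family (ltw_L alpha),
          left_module_trace g t /\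
          (forall f : hhom (preg H) (twist (ltw_L alpha) (preg H)),
             t (preg H) f = mu ((g : H)^-1 * f (1 : H)))
        & forall t' : trace_family (ltw_L alpha),
          left_module_trace g t' ->
          (forall f : hhom (preg H) (twist (ltw_L alpha) (preg H)),
             t' (preg H) f = mu ((g : H)^-1 * f (1 : H))) ->
          forall P f, t' P f = t P f] /\
  ((exists2 t : trace_family (rtw_id H), right_modified_trace g t & nonzero_trace t)
     <-> unimodular alpha) /\
  ((exists2 t : trace_family (ltw_id H), left_modified_trace g t & nonzero_trace t)
     <-> unimodular alpha).
Proof.
have [c [c0 cl cr]] := halpha.
have rtwE : nu =1 alpha -> rtw_R nu =1 Rmap alpha.
  by move=> nuE a; apply: eq_sw => x y; rewrite nuE.
have ltwE : nu =1 alpha -> ltw_L nu =1 Lmap alpha.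
  by move=> nuE a; apply: eq_sw => x y; rewrite nuE.
split; last split; last split.
- split.
  + by move/rtwE; apply: right_module_trace_dim1.
  + move=> nu_alpha t; split=> [t_mod P f | t0].
      apply/eqP/negP => /negP tf0; apply: nu_alpha => a.
      rewrite -[LHS]counit_Rmap -[RHS]counit_Rmap; congr (counit _).
      by apply: (right_module_trace_modulus halpha t_mod); exists P, f.
    by split=> [P P' f h | P V f]; rewrite !t0.
  + exact: (right_module_trace_nondegenerate halpha).
  + move=> t t_mod; have [mu mu_int tE] := right_module_trace_integral t_mod.
    by exists mu => // f; rewrite trace_formE tE mul_formE.
  + by move=> mu; apply: (right_integral_trace g halpha).
- split.
  + by move/ltwE; apply: left_module_trace_dim1.
  + move=> nu_alpha t; split=> [t_mod P f | t0].
      apply/eqP/negP => /negP tf0; apply: nu_alpha => a.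
      rewrite -[LHS]counit_Lmap -[RHS]counit_Lmap; congr (counit _).
      by apply: (left_module_trace_modulus halpha t_mod); exists P, f.
    by split=> [P P' f h | P V f]; rewrite !t0.
  + move=> t t_mod; have [mu mu_int tE] := left_module_trace_integral t_mod.
    by exists mu => // f; rewrite trace_formE tE mul_formE.
  + by move=> mu; apply: (left_integral_trace g halpha).
- split=> [[t t_mod t_neq0] a | alphaE].
    rewrite -[LHS]counit_Rmap; congr (counit _); symmetry.
    exact: (right_module_trace_modulus halpha t_mod t_neq0).
  have [t t_neq0 tP] : trace_space_dim1 (@right_module_trace K H g (rtw_id H)).
    apply: (right_module_trace_dim1 g halpha) => a /=.
    by rewrite -[LHS]counitl; apply: eq_sw => x y; rewrite alphaE.
  by exists t => //; apply/tP; exists 1 => P f; rewrite mul1r.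
- split=> [[t t_mod t_neq0] a | alphaE].
    rewrite -[LHS]counit_Lmap; congr (counit _); symmetry.
    exact: (left_module_trace_modulus halpha t_mod t_neq0).
  have [t t_neq0 tP] : trace_space_dim1 (@left_module_trace K H g (ltw_id H)).
    apply: (left_module_trace_dim1 g halpha) => a /=.
    by rewrite -[LHS]counitr; apply: eq_sw => x y; rewrite alphaE.
  by exists t => //; apply/tP; exists 1 => P f; rewrite mul1r.
Qed.
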